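(* Let $F:\mathbb{C}\to B(\mathfrak{X})$ be entire and let $\mathcal{H}=\mathcal{H}_F$. Suppose there exist an orthonormal basis $\{u_n\}_{n\ge1}$ of $\mathfrak{X}$, points $\{z_n\}_{n\ge1}\subseteq\mathbb{C}$ and nonzero numbers $\{c_n\}$ with $F(z_n)u=c_n\langle u,u_n\rangle_{\mathfrak{X}}u_n$ for all $u\in\mathfrak{X}$, $n\in\mathbb{N}$ (so every $f\in\mathcal{H}$ satisfies $f(z)=\sum_n\langle f(z_n),u_n\rangle_{\mathfrak{X}}F_n(z)/c_n$ with $F_n=F(\cdot)u_n$). Then the following are equivalent: (a) there exist a scalar entire function $Q$ whose zeros are exactly the points $z_n$, all simple, and an $\mathfrak{X}$-valued entire function $A$ with $A(z)\neq0$ for all $z$ and $\langle A(z_n),u_n\rangle_{\mathfrak{X}}\ne0$ for all $n$, such that every $f\in\mathcal{H}$ satisfies $$f(z)=\sum_{n=1}^\infty\langle f(z_n),u_n\rangle_{\mathfrak{X}}\frac{Q(z)}{(z-z_n)Q'(z_n)}\frac{A(z)}{\langle A(z_n),u_n\rangle_{\mathfrak{X}}},\qquad z\in\mathbb{C};$$ (b) $R_z\mathcal{H}_z\subseteq\mathcal{H}$ for all $z\in\mathbb{C}$.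
   Context: $\mathfrak{X}$ is a complex separable Hilbert space. $\mathcal{H}_F=\{f_u:u\in\mathfrak{X}\}$, $f_u(z)=F(z)u$, with norm $\|f_u\|=\inf\{\|w\|_{\mathfrak{X}}:F(\cdot)w=f_u\}$, a reproducing kernel Hilbert space of entire functions. For $\beta\in\mathbb{C}$, $\mathcal{H}_\beta=\{f\in\mathcal{H}:f(\beta)=0\}$ and for $f\in\mathcal{H}_\beta$, $(R_\beta f)(z)=\frac{f(z)}{z-\beta}$ ($z\ne\beta$), $(R_\beta f)(\beta)=f'(\beta)$. *)

(* Defs.v *)
From HB Require Import structures.
From mathcomp Require Import all_boot all_order all_algebra.
From mathcomp Require Import all_classical all_reals all_analysis.
From mathcomp Require Export complex.
Import Order.TTheory GRing.Theory Num.Theory.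
Import numFieldNormedType.Exports.

Set Implicit Arguments.
Unset Strict Implicit.
Unset Printing Implicit Defensive.

Local Open Scope ring_scope.
Local Open Scope classical_set_scope.

Section Defs.
Variable R : realType.
(* the complex numbers are R[i]; the Hilbert space is a complete normed
   space over R[i] whose norm is induced by an inner product *)
Variable X : completeNormedModType R[i].

Definition is_inner_product (ip : X -> X -> R[i]) : Prop :=
  [/\ forall (a : R[i]) (x y z : X), ip (a *: x + y) z = a * ip x z + ip y z,
      forall x y : X, ip y x = conjc (ip x y)
    & forall x : X, ip x x = `|x| ^+ 2].

Definition separable_space : Prop :=
  exists d : nat -> X, forall (x : X) (e : R[i]), 0 < e ->
    exists n, `|x - d n| < e.

Definition orthonormal_basis (ip : X -> X -> R[i]) (u : nat -> X) : Prop :=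
  (forall n m : nat, ip (u n) (u m) = (n == m)%:R) /\
  (forall x : X, (forall n, ip x (u n) = 0) -> x = 0).

Definition bounded_linear (T : X -> X) : Prop :=
  (forall (a : R[i]) (x y : X), T (a *: x + y) = a *: T x + T y) /\
  (exists M : R[i], forall x : X, `|T x| <= M * `|x|).

(* F : C -> B(X) is entire: complex differentiable at every point
   with respect to the operator norm. *)
Definition op_entire (F : R[i] -> X -> X) : Prop :=
  (forall z, bounded_linear (F z)) /\
  forall z0 : R[i], exists L : X -> X, bounded_linear L /\
    forall e : R[i], 0 < e -> exists d : R[i], 0 < d /\
      forall z : R[i], 0 < `|z - z0| < d -> forall x : X,
        `|(z - z0)^-1 *: (F z x - F z0 x) - L x| <= e * `|x|.

End Defs.

Definition cderiv (R : realType) (V : normedModType R[i]) (f : R[i] -> V)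
  (z : R[i]) : V := 'D_1 (f : R[i]^o -> V) (z : R[i]^o).

Definition entire (R : realType) (V : normedModType R[i]) (f : R[i] -> V) : Prop :=
  forall z : R[i], derivable (f : R[i]^o -> V) (z : R[i]^o) 1.

Definition in_HF (R : realType) (X : completeNormedModType R[i])
  (F : R[i] -> X -> X) (f : R[i] -> X) : Prop :=
  exists u : X, f = (fun z => F z u).

(* The operator R_beta on H_beta = { f \in H : f beta = 0 }:
   (R_beta f)(z) = f(z)/(z - beta) for z <> beta, and f'(beta) at beta. *)
Definition Rop (R : realType) (X : completeNormedModType R[i])
  (beta : R[i]) (f : R[i] -> X) : R[i] -> X :=
  fun z => if z == beta then cderiv f beta else (z - beta)^-1 *: f z.

(* The scalar kernel Q(z)/(z - w), extended by continuity (Q'(w)) at z = w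
   when Q(w) = 0. *)
Definition Qker (R : realType) (Q : R[i] -> R[i]) (w z : R[i]) : R[i] :=
  if z == w then cderiv (Q : R[i] -> R[i]^o) w else Q z / (z - w).

(* Main.v *)
(* Write v = sum v_n u_n and F_n = F(.) u_n.

   From the expansion to division: a function f = F(.) v vanishing at b is divided
   by z - b through the vector with coefficients v_n / (z_n - b), which is in l^2
   because the zeros of Q are isolated; partial fractions turn the expansion of
   the quotient into that of f, up to a multiple of Q A, which vanishes when b is
   not a node and is absorbed by a multiple of u_k when b = z_k.

   From division to the expansion: dividing F_n by z - z_0 shows that
   (z - z_n) F_n is a multiple k_n G of one function G independent of n, whose zeros
   are exactly the z_n, all simple.  The nodes therefore do not accumulate, so
   the Weierstrass product theorem gives a scalar Q = (z - z_n) q_n with these zeros, and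
   A = G / Q = F_n / (k_n q_n) is entire without zeros.  The expansion is then
   the image of v = sum v_n u_n under F(z).

   The Weierstrass theorem is proved without Cauchy's theory.  The bounds [ctl]
   on a function, on its difference quotients and on its second-order Taylor
   remainder on a disk are stable under products, compositions and limits, so
   locally uniform limits controlled in this sense are again differentiable. *)
Require Import Defs.
From HB Require Import structures.
From mathcomp Require Import all_boot all_order all_algebra.
From mathcomp Require Import all_classical all_reals all_analysis.
From mathcomp Require Import complex ring lra.
Import Order.TTheory GRing.Theory Num.Theory.
Import numFieldNormedType.Exports.
Local Open Scope ring_scope.
Local Open Scope classical_set_scope.

Set Implicit Arguments.
Unset Strict Implicit.
Unset Printing Implicit Defensive.

(** * The real-valued norm *)

(** The norm over [R[i]] takes values in [R[i]]. Its real part loses nothing and turns estimates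
    into inequalities between reals. *)
Definition rnorm (R : realType) (V : normedZmodType R[i]) (x : V) : R :=
  complex.Re `|x|.

Section Rnorm.
Local Open Scope complex_scope.
Context {R : realType}.
Implicit Types (V : normedZmodType R[i]) (W : normedModType R[i]).

Lemma rnormE V (x : V) : `|x| = (rnorm x)%:C.
Proof. by have /ger0_real/RRe_real := normr_ge0 x. Qed.

Lemma rnorm_ge0 V (x : V) : 0 <= rnorm x.
Proof. by have := normr_ge0 x; rewrite rnormE lecR. Qed.

Lemma rnorm_eq0 V (x : V) : (rnorm x == 0) = (x == 0).
Proof. by rewrite -[RHS]normr_eq0 rnormE; apply/eqP/eqP => [-> //|[]]. Qed.

Lemma rnorm0 V : rnorm (0 : V) = 0.
Proof. by apply/eqP; rewrite rnorm_eq0. Qed.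

Lemma rnorm_gt0 V (x : V) : (0 < rnorm x) = (x != 0).
Proof. by rewrite lt_def rnorm_ge0 andbT rnorm_eq0. Qed.

Lemma rnormD V (x y : V) : rnorm (x + y) <= rnorm x + rnorm y.
Proof. by have := ler_normD x y; rewrite !rnormE -rmorphD lecR. Qed.

Lemma rnormN V (x : V) : rnorm (- x) = rnorm x.
Proof. by rewrite /rnorm normrN. Qed.

Lemma rdistC V (x y : V) : rnorm (x - y) = rnorm (y - x).
Proof. by rewrite -opprB rnormN. Qed.

Lemma rnormZ W (a : R[i]) (x : W) : rnorm (a *: x) = rnorm a * rnorm x.
Proof. by have := normrZ a x; rewrite !rnormE -rmorphM => -[]. Qed.

Lemma rnormM (a b : R[i]) : rnorm (a * b) = rnorm a * rnorm b.
Proof. by have := normrM a b; rewrite !rnormE -rmorphM => -[]. Qed.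

Lemma rnormV (a : R[i]) : rnorm a^-1 = (rnorm a)^-1.
Proof. by have := normfV a; rewrite !rnormE -fmorphV => -[]. Qed.

Lemma rnorm1 : rnorm (1 : R[i]) = 1.
Proof. by rewrite /rnorm normr1. Qed.

Lemma rnorm_real (x : R) : rnorm (x%:C) = `|x|.
Proof. by rewrite /rnorm normc_def /= expr0n /= addr0 sqrtr_sqr. Qed.

Lemma le_rnorm_Re (z : R[i]) : `|complex.Re z| <= rnorm z.
Proof. by have := normc_ge_Re z; rewrite rnormE lecR. Qed.

Lemma le_rnorm_Im (z : R[i]) : `|complex.Im z| <= rnorm z.
Proof.
rewrite /rnorm normc_def /= -sqrtr_sqr ler_sqrt; last by rewrite addr_ge0 ?sqr_ge0.
by rewrite lerDr sqr_ge0.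
Qed.

Lemma rnorm_le_ReIm (z : R[i]) : rnorm z <= `|complex.Re z| + `|complex.Im z|.
Proof.
rewrite /rnorm normc_def /=.
set a := complex.Re z; set b := complex.Im z.
have ab0 : 0 <= `|a| + `|b| by rewrite addr_ge0.
rewrite -[X in _ <= X](ger0_norm ab0) -sqrtr_sqr ler_sqrt ?sqr_ge0//.
rewrite sqrrD !real_normK ?num_real// lerD2r lerDl mulrn_wge0// mulr_ge0//.
Qed.

(** A positive element of [R[i]] is real, so every epsilon of a limit over [R[i]] comes from [R]. *)
Lemma eps_real (e : R[i]) : 0 < e -> exists2 r : R, 0 < r & e = r%:C.
Proof.
move=> e0; exists (complex.Re e); last by rewrite RRe_real ?gtr0_real.
by rewrite -ltcR RRe_real ?gtr0_real.
Qed.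

End Rnorm.

(** * Limits of sequences *)

Definition tends (R : realType) (V : normedZmodType R[i]) (f : nat -> V) (l : V) :=
  forall e : R, 0 < e -> exists N, forall n, (N <= n)%N -> rnorm (f n - l) < e.

Section Tends.
Context {R : realType}.
Local Open Scope complex_scope.
Implicit Types (V : normedZmodType R[i]) (W : normedModType R[i]).

(** Comparison estimate behind the limit rules below. [K] may have any sign, hence [|K| + 1] in the
    proof. *)
Lemma tends_dom V V1 V2 (f : nat -> V) l (g : nat -> V1) m (h : nat -> V2) p
  (K : R) (N0 : nat) :
  (forall n, (N0 <= n)%N ->
    rnorm (f n - l) <= K * rnorm (g n - m) + K * rnorm (h n - p)) ->
  tends g m -> tends h p -> tends f l.
Proof.
move=> fgh gm hp e e0.
have K0 : 0 < `|K| + 1 by rewrite ltr_wpDl.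
have e1 : 0 < e / 2 / (`|K| + 1) by rewrite !divr_gt0.
have [N Ng] := gm _ e1; have [M Mh] := hp _ e1.
exists (maxn N0 (maxn N M)) => n; rewrite !geq_max => /and3P[n0 nN nM].
have := fgh n n0; move: (Ng n nN) (Mh n nM); rewrite !ltr_pdivlMr//.
have := rnorm_ge0 (g n - m); have := rnorm_ge0 (h n - p).
have := ler_norm K; nra.
Qed.

Lemma tends_cst V (l : V) : tends (fun=> l) l.
Proof. by move=> e e0; exists 0 => n _; rewrite subrr rnorm0. Qed.

Lemma tends_near V (f g : nat -> V) (l : V) N :
  (forall n, (N <= n)%N -> f n = g n) -> tends g l -> tends f l.
Proof.
move=> fg /(_ _ _)gl e e0; have [M Mg] := gl e e0.
by exists (maxn N M) => n; rewrite geq_max => /andP[? ?]; rewrite fg// Mg.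
Qed.

Lemma tendsD V (f g : nat -> V) l m :
  tends f l -> tends g m -> tends (fun n => f n + g n) (l + m).
Proof.
apply: (tends_dom (K := 1) (N0 := 0)) => n _.
by rewrite opprD addrACA !mul1r rnormD.
Qed.

Lemma tendsN V (f : nat -> V) l : tends f l -> tends (fun n => - f n) (- l).
Proof.
move=> fl; apply: (tends_dom (K := 1) (N0 := 0) _ fl fl) => n _.
rewrite -opprD rnormN; have := rnorm_ge0 (f n - l); lra.
Qed.

Lemma tendsB V (f g : nat -> V) l m :
  tends f l -> tends g m -> tends (fun n => f n - g n) (l - m).
Proof. by move=> fl gm; apply: tendsD => //; apply: tendsN. Qed.

Lemma tends_uniq V (f : nat -> V) l m : tends f l -> tends f m -> l = m.
Proof.
move=> fl fm; apply/eqP; rewrite -subr_eq0 -rnorm_eq0; apply/eqP/le_anti.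
rewrite rnorm_ge0 andbT leNgt; apply/negP => lm.
have e0 : 0 < rnorm (l - m) / 2 by lra.
have [N Nl] := fl _ e0; have [M Mm] := fm _ e0.
have := Nl _ (leq_maxl N M); have := Mm _ (leq_maxr N M).
set x := f _; have := rnormD (l - x) (x - m).
by rewrite addrA subrK (rdistC l x); lra.
Qed.

Lemma tends_ub V (f : nat -> V) l (K : R) N :
  (forall n, (N <= n)%N -> rnorm (f n) <= K) -> tends f l -> rnorm l <= K.
Proof.
move=> fK fl; apply/ler_addgt0Pr => e /fl[M Mf].
have := Mf _ (leq_maxl M N); have := fK _ (leq_maxr M N).
set x := f _; have := rnormD (l - x) x.
by rewrite subrK rdistC; lra.
Qed.

Lemma tends_lb V (f : nat -> V) l (K : R) N :
  (forall n, (N <= n)%N -> K <= rnorm (f n)) -> tends f l -> K <= rnorm l.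
Proof.
move=> fK fl; apply/ler_addgt0Pr => e /fl[M Mf].
have := Mf _ (leq_maxl M N); have := fK _ (leq_maxr M N).
set x := f _; have := rnormD (x - l) l.
by rewrite subrK; lra.
Qed.

Lemma tendsZ W (k : nat -> R[i]) (f : nat -> W) a l :
  tends k a -> tends f l -> tends (fun n => k n *: f n) (a *: l).
Proof.
(* From [N] on, [f n] stays within 1 of [l], which yields the constant [rnorm a + rnorm l + 1]. *)
move=> ka fl; have [N Nf] := fl 1 ltr01.
apply: (tends_dom (K := rnorm a + rnorm l + 1) (N0 := N) _ ka fl) => n /Nf.
have -> : k n *: f n - a *: l = (k n - a) *: f n + a *: (f n - l).
  by rewrite scalerBl scalerBr addrA subrK.
move=> fn1; have := rnormD ((k n - a) *: f n) (a *: (f n - l)); rewrite !rnormZ.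
have := rnormD (f n - l) l; rewrite subrK.
have := rnorm_ge0 (k n - a); have := rnorm_ge0 (f n - l).
have := rnorm_ge0 l; have := rnorm_ge0 a; have := rnorm_ge0 (f n); nra.
Qed.

Lemma tendsM (f g : nat -> R[i]) a b :
  tends f a -> tends g b -> tends (fun n => f n * g n) (a * b).
Proof. exact: (@tendsZ (R[i]^o)). Qed.

Lemma tends_cvg W (f : nat -> W) l : f @ \oo --> l <-> tends f l.
Proof.
split=> [/cvgrPdist_lt fl e e0|fl].
  have /fl[N _ Nf] : 0 < e%:C by rewrite ltcR.
  exists N => n Nn; have := Nf n Nn; rewrite /= rnormE ltcR rdistC //.
apply/cvgrPdist_lt => e /eps_real[r r0 ->].
have [N Nf] := fl r r0; exists N => // n Nn /=.
by rewrite rnormE ltcR rdistC; exact: Nf.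
Qed.

(** Comparing with the single index [N] gives the usual Cauchy condition up to a factor 2. *)
Definition rcauchy V (f : nat -> V) := forall e : R, 0 < e ->
  exists N, forall n, (N <= n)%N -> rnorm (f n - f N) < e.

Lemma real_cauchy_cvg (f : nat -> R) :
  (forall e, 0 < e -> exists N, forall n, (N <= n)%N -> `|f n - f N| < e) ->
  exists l, forall e, 0 < e -> exists N, forall n, (N <= n)%N -> `|f n - l| < e.
Proof.
move=> fC; have : cvg (f @ \oo).
  apply: cauchy_cvg; apply: cauchy_exP => e e0; have [N Nf] := fC e e0.
  exists (f N); exists N => // n Nn /=.
  by rewrite /ball/= distrC Nf.
move=> /cvg_ex[l /cvgrPdist_lt fl]; exists l => e /fl[N _ Nf]; exists N => n Nn.
by rewrite distrC; exact: Nf.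
Qed.

(** Real and imaginary parts are Cauchy, as the modulus dominates both. *)
Lemma complex_complete (f : nat -> R[i]) : rcauchy f -> exists l, tends f l.
Proof.
move=> fC.
have [e e0|a fa] := @real_cauchy_cvg (fun n => complex.Re (f n)).
  have [N Nf] := fC e e0; exists N => n /Nf; apply: le_lt_trans.
  by rewrite -raddfB le_rnorm_Re.
have [e e0|b fb] := @real_cauchy_cvg (fun n => complex.Im (f n)).
  have [N Nf] := fC e e0; exists N => n /Nf; apply: le_lt_trans.
  by rewrite -raddfB le_rnorm_Im.
exists (Complex a b) => e e0; have e2 : 0 < e / 2 by lra.
have [N Na] := fa _ e2; have [M Mb] := fb _ e2.
exists (maxn N M) => n; rewrite geq_max => /andP[/Na + /Mb].
have := rnorm_le_ReIm (f n - Complex a b); rewrite !raddfB /=; lra.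
Qed.

Lemma complete_tends (W : completeNormedModType R[i]) (f : nat -> W) :
  rcauchy f -> exists l, tends f l.
Proof.
move=> fC; have /cvg_ex[l /tends_cvg ?] : cvg (f @ \oo); last by exists l.
apply: cauchy_cvg; apply: cauchy_exP => e /eps_real[r r0 ->].
have [N Nf] := fC r r0; exists (f N); exists N => // n Nn /=.
by rewrite -ball_normE /ball_/= rnormE ltcR rdistC Nf.
Qed.

End Tends.

(** * Second-order control on disks *)

Section Ctl.
Local Open Scope complex_scope.
Context {R : realType}.
Local Notation C := R[i].
Implicit Types (r b c : R) (f g : C -> C).

(* [f'] is the derivative of [f] on the disk, with Lipschitz-type error bounds *)
Definition ctl r f f' b := forall z : C, rnorm z <= r ->
  [/\ rnorm (f z) <= b, rnorm (f' z) <= b & forall w : C, rnorm w <= r ->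
    rnorm (f w - f z) <= b * rnorm (w - z) /\
    rnorm (f w - f z - (w - z) * f' z) <= b * rnorm (w - z) ^+ 2].

Lemma ctl_ge0 r f f' b : 0 <= r -> ctl r f f' b -> 0 <= b.
Proof.
move=> r0 /(_ 0); rewrite rnorm0 => /(_ r0)[fb _ _].
exact: le_trans (rnorm_ge0 _) fb.
Qed.

Lemma ctl_le r r' f f' b b' :
  r' <= r -> b <= b' -> ctl r f f' b -> ctl r' f f' b'.
Proof.
move=> rr bb fb z zr; have [f1 f2 f3] := fb z (le_trans zr rr).
split; rewrite ?(le_trans f1)// ?(le_trans f2)// => w wr.
have [f4 f5] := f3 w (le_trans wr rr).
by split; [apply: (le_trans f4)|apply: (le_trans f5)]; apply: ler_wpM2r => //;
  rewrite ?exprn_ge0 ?rnorm_ge0.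
Qed.

Lemma ctl_eq r f f' g g' b :
  (forall z, rnorm z <= r -> f z = g z) -> (forall z, rnorm z <= r -> f' z = g' z) ->
  ctl r f f' b -> ctl r g g' b.
Proof.
move=> fg fg' fb z zr; have [f1 f2 f3] := fb z zr.
rewrite -!fg// -fg'//; split => // w wr; rewrite -fg//; exact: f3.
Qed.

Lemma ctl_cst r (a : C) : ctl r (fun=> a) (fun=> 0) (rnorm a).
Proof.
move=> z _; split; rewrite ?rnorm0 ?rnorm_ge0// => w _.
by rewrite subrr mulr0 subr0 rnorm0 !mulr_ge0 ?exprn_ge0 ?rnorm_ge0.
Qed.

(** The bound has to dominate both [r] and the derivative 1. *)
Lemma ctl_id r : 0 <= r -> ctl r id (fun=> 1) (r + 1).
Proof.
move=> r0 z zr; split; rewrite ?rnorm1; [lra|lra|] => w _.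
rewrite mulr1 subrr rnorm0; have := rnorm_ge0 (w - z); split; nra.
Qed.

Lemma ctlD r f f' b g g' c : ctl r f f' b -> ctl r g g' c ->
  ctl r (fun z => f z + g z) (fun z => f' z + g' z) (b + c).
Proof.
move=> fb gc z zr; have [f1 f2 f3] := fb z zr; have [g1 g2 g3] := gc z zr.
split; [exact: le_trans (rnormD _ _) (lerD _ _)|exact: le_trans (rnormD _ _) (lerD _ _)|].
move=> w wr; have [f4 f5] := f3 w wr; have [g4 g5] := g3 w wr.
split; rewrite [(b + c) * _]mulrDl.
  by rewrite opprD addrACA (le_trans (rnormD _ _) (lerD _ _)).
have -> : f w + g w - (f z + g z) - (w - z) * (f' z + g' z) =
  f w - f z - (w - z) * f' z + (g w - g z - (w - z) * g' z) by ring.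
exact: le_trans (rnormD _ _) (lerD _ _).
Qed.

Lemma ctlZ r f f' b (a : C) : ctl r f f' b ->
  ctl r (fun z => a * f z) (fun z => a * f' z) (rnorm a * b).
Proof.
move=> fb z zr; have [f1 f2 f3] := fb z zr.
have a0 := rnorm_ge0 a.
split; rewrite ?rnormM ?ler_wpM2l// => w wr; have [f4 f5] := f3 w wr.
rewrite -mulrBr rnormM -!mulrA ler_wpM2l//; split=> //.
rewrite mulrCA -mulrBr rnormM ler_wpM2l//.
Qed.

Lemma ctlB r f f' b g g' c : ctl r f f' b -> ctl r g g' c ->
  ctl r (fun z => f z - g z) (fun z => f' z - g' z) (b + c).
Proof.
move=> fb /(ctlZ (-1)); rewrite rnormN rnorm1 mul1r => gc.
by apply: ctl_eq (ctlD fb gc) => z _; rewrite mulN1r.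
Qed.

(** The 3 counts the terms into which the second-order remainder of a product splits, each at most b
    c |w - z|^2. *)
Lemma ctlM r f f' b g g' c : ctl r f f' b -> ctl r g g' c ->
  ctl r (fun z => f z * g z) (fun z => f' z * g z + f z * g' z) (3 * b * c).
Proof.
move=> fb gc z zr; have [f1 f2 f3] := fb z zr; have [g1 g2 g3] := gc z zr.
have f0 := rnorm_ge0 (f z); have g0 := rnorm_ge0 (g z).
have f'0 := rnorm_ge0 (f' z); have g'0 := rnorm_ge0 (g' z).
split.
- rewrite rnormM; nra.
- apply: le_trans (rnormD _ _) _; rewrite !rnormM; nra.
move=> w wr; have [f4 f5] := f3 w wr; have [g4 g5] := g3 w wr.
have [gw _ _] := gc w wr; have gw0 := rnorm_ge0 (g w).
have h0 := rnorm_ge0 (w - z).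
have b0 : 0 <= b by lra.
have c0 : 0 <= c by lra.
split.
  have -> : f w * g w - f z * g z = (f w - f z) * g w + f z * (g w - g z) by ring.
  apply: le_trans (rnormD _ _) _; rewrite !rnormM.
  have := ler_pM (rnorm_ge0 _) gw0 f4 gw.
  have := ler_pM f0 (rnorm_ge0 _) f1 g4.
  have := mulr_ge0 (mulr_ge0 b0 c0) h0; nra.
have -> : f w * g w - f z * g z - (w - z) * (f' z * g z + f z * g' z) =
  (f w - f z - (w - z) * f' z) * g w + (w - z) * f' z * (g w - g z)
  + f z * (g w - g z - (w - z) * g' z) by ring.
apply: le_trans (rnormD _ _) _; apply: (le_trans (lerD (rnormD _ _) (lexx _))).
rewrite !rnormM.
have := ler_pM (rnorm_ge0 _) gw0 f5 gw.
have := ler_pM f0 (rnorm_ge0 _) f1 g5.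
have := ler_pM (mulr_ge0 h0 f'0) (rnorm_ge0 _) (ler_wpM2l h0 f2) g4.
nra.
Qed.

(* Quadratic in [b] only to second order: composing with a small inner function
   gives a small outer increment. *)
Lemma ctl_comp r rho f f' K h h' b :
  0 <= rho -> b <= rho -> ctl rho f f' K -> ctl r h h' b ->
  ctl r (fun z => f (h z) - f 0) (fun z => h' z * f' (h z)) (K * (b + b ^+ 2)).
Proof.
move=> rho0 brho fK hb z zr; have [h1 h2 h3] := hb z zr.
have [f1 f2 f3] := fK _ (le_trans h1 brho).
have hz0 := rnorm_ge0 (h z); have h'0 := rnorm_ge0 (h' z).
have K0 := ctl_ge0 rho0 fK.
have Kb0 : 0 <= K * b by apply: mulr_ge0 => //; lra.
have Kb20 : 0 <= K * b ^+ 2 by apply: mulr_ge0; rewrite ?sqr_ge0.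
split.
- have [|_ _ /(_ (h z) (le_trans h1 brho))[]] := fK 0; rewrite ?rnorm0// subr0.
  have := ler_wpM2l K0 h1; lra.
- rewrite rnormM; have := ler_pM h'0 (rnorm_ge0 _) h2 f2; lra.
move=> w wr; have [h4 h5] := h3 w wr; have [hw _ _] := hb w wr.
have [f4 f5] := f3 _ (le_trans hw brho).
have d0 := rnorm_ge0 (w - z); have hh0 := rnorm_ge0 (h w - h z).
rewrite opprB addrA subrK; split.
  have := ler_wpM2l K0 h4; have := mulr_ge0 Kb20 d0; lra.
have -> : f (h w) - f (h z) - (w - z) * (h' z * f' (h z)) =
  (f (h w) - f (h z) - (h w - h z) * f' (h z))
  + (h w - h z - (w - z) * h' z) * f' (h z) by ring.
apply: le_trans (rnormD _ _) _; rewrite rnormM.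
have := ler_pM (rnorm_ge0 _) (rnorm_ge0 _) h5 f2.
have : rnorm (h w - h z) ^+ 2 <= (b * rnorm (w - z)) ^+ 2.
  by rewrite lerXn2r ?nnegrE// mulr_ge0//; lra.
move/(ler_wpM2l K0); rewrite exprMn; lra.
Qed.

(* A map with quadratically small increments has zero derivative; here this is
   turned into constancy by subdividing the segment [0, z]. *)
Lemma ctl_derivative0_cst r f b : ctl r f (fun=> 0) b ->
  forall z, rnorm z <= r -> f z = f 0.
Proof.
move=> fb z zr; have r0 : 0 <= r := le_trans (rnorm_ge0 z) zr.
have b0 := ctl_ge0 r0 fb.
(* Division points of [0, z] cut into n + 1 equal pieces. *)
pose s (n k : nat) : C := (k%:R / n.+1%:R : R)%:C * z.
have sr n k : (k <= n.+1)%N -> rnorm (s n k) <= rnorm z.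
  move=> kn; rewrite rnormM rnorm_real ger0_norm ?divr_ge0//.
  by rewrite -[leRHS]mul1r ler_wpM2r ?rnorm_ge0// ler_pdivrMr// mul1r ler_nat.
(* Each piece contributes at most b (|z| / (n + 1))^2. *)
have step n k : (k <= n.+1)%N ->
    rnorm (f (s n k) - f 0) <= b * (rnorm z ^+ 2) * (k%:R / n.+1%:R ^+ 2).
  elim: k => [_|k IH kn].
    by rewrite /s mul0r mul0r rmorph0 mul0r subrr rnorm0 mulr0.
  have [_ _ /(_ (s n k.+1) (le_trans (sr _ _ kn) zr))[_]] :=
    fb (s n k) (le_trans (sr _ _ (ltnW kn)) zr).
  rewrite mulr0 subr0 => e1; have := IH (ltnW kn).
  have := rnormD (f (s n k.+1) - f (s n k)) (f (s n k) - f 0).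
  rewrite addrA subrK; move: e1.
  have -> : s n k.+1 - s n k = (n.+1%:R^-1)%:C * z.
    by rewrite /s -mulrBl -rmorphB -mulrBl -natrB// subSnn mul1r.
  rewrite rnormM rnorm_real ger0_norm ?invr_ge0// exprMn exprVn -natr1.
  set x := _ ^-1; lra.
apply/eqP; rewrite -subr_eq0 -rnorm_eq0; apply/eqP/le_anti; rewrite rnorm_ge0 andbT.
set D := b * rnorm z ^+ 2.
have D0 : 0 <= D by rewrite mulr_ge0// exprn_ge0// rnorm_ge0.
apply/ler_addgt0Pr => e e0; rewrite add0r.
(* With k = n + 1 the bound becomes D / (n + 1), which this choice brings below e. *)
pose n := Num.truncn (D / e).
have nD : D / e < n.+1%:R by rewrite truncnS_gt.
have := step n n.+1 (leqnn _).
have n0 : n.+1%:R != 0 :> R by rewrite pnatr_eq0.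
have -> : s n n.+1 = z.
  rewrite -[RHS]mul1r -(rmorph1 (real_complex R)); congr (_%:C * _).
  exact: divff.
move=> /le_trans; apply.
have -> : n.+1%:R / n.+1%:R ^+ 2 = n.+1%:R^-1 :> R.
  by rewrite expr2 invfM mulrA divff// mul1r.
by rewrite -/D ler_pdivrMr// -ler_pdivrMl// mulrC ltW.
Qed.

(** The limit as a total function; it is 0 by default when no limit exists. *)
Definition limC (f : nat -> C) : C := xget 0 [set l | tends f l].

Lemma limC_tends (f : nat -> C) : (exists l, tends f l) -> tends f (limC f).
Proof. exact: (@xgetPex _ 0 [set l | tends f l]). Qed.

Lemma limCE (f : nat -> C) l : tends f l -> limC f = l.
Proof. by move=> fl; apply: (tends_uniq _ fl); apply: limC_tends; exists l. Qed.

(** [T n] dominates the sum of all [t k] with k >= n. The form covers geometric and exponential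
    tails alike. *)
Definition tail_bound (t T : nat -> R) :=
  [/\ forall n, 0 <= T n, forall n, t n + T n.+1 <= T n &
    forall e, 0 < e -> exists n, T n < e].

(** The bounds of [ctl] are closed conditions at fixed points, so they pass to pointwise limits;
    this makes the limit of the derivatives the derivative of the limit. *)
Lemma ctl_lim r (f f' : nat -> C -> C) t T : 0 <= r ->
  (forall n, ctl r (fun z => f n.+1 z - f n z) (fun z => f' n.+1 z - f' n z) (t n)) ->
  tail_bound t T ->
  (forall n, ctl r (fun z => limC (f ^~ z) - f n z)
    (fun z => limC (f' ^~ z) - f' n z) (T n)) /\
  (forall z, rnorm z <= r -> tends (f ^~ z) (limC (f ^~ z)) /\
    tends (f' ^~ z) (limC (f' ^~ z))).
Proof.
move=> r0 ft [T0 Tt Te].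
(* The increments telescope: the bound is in fact T n - T (n + k). *)
have fT n k : ctl r (fun z => f (n + k)%N z - f n z)
    (fun z => f' (n + k)%N z - f' n z) (T n).
  apply: (@ctl_le r _ _ _ (T n - T (n + k)%N)) => //; first by rewrite gerBl.
  elim: k => [|k IH].
    rewrite addn0 subrr; have := @ctl_cst r 0; rewrite rnorm0.
    by apply: ctl_eq => z _; rewrite subrr.
  rewrite addnS; apply: (@ctl_le r _ _ _ (t (n + k)%N + (T n - T (n + k)%N))) => //.
    have := Tt (n + k)%N; lra.
  by apply: ctl_eq (ctlD (ft (n + k)%N) IH) => z _; rewrite addrA subrK.
have lims z : rnorm z <= r -> tends (f ^~ z) (limC (f ^~ z)) /\
    tends (f' ^~ z) (limC (f' ^~ z)).
  move=> zr; split; apply: limC_tends; apply: complex_complete => e /Te[n ne];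
  by exists n => m nm; have [f1 f2 _] := fT n (m - n)%N z zr;
    apply: le_lt_trans ne; rewrite subnKC in f1 f2.
split=> // n z zr; have [lz lz'] := lims z zr.
split.
- apply: (tends_ub (N := n)) (tendsB lz (tends_cst _)) => m nm.
  by have [f1 _ _] := fT n (m - n)%N z zr; rewrite subnKC in f1.
- apply: (tends_ub (N := n)) (tendsB lz' (tends_cst _)) => m nm.
  by have [_ f1 _] := fT n (m - n)%N z zr; rewrite subnKC in f1.
move=> w wr; have [lw _] := lims w wr.
have tn (g : nat -> C) (a : C) : tends g a -> tends (fun m => g m - g n) (a - g n).
  by move=> ga; apply: tendsB (tends_cst _).
split.
- apply: (tends_ub (N := n)) (tendsB (tn _ _ lw) (tn _ _ lz)) => m nm.
  by have [_ _ /(_ w wr)[f1 _]] := fT n (m - n)%N z zr; rewrite subnKC in f1.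
- apply: (tends_ub (N := n)) (tendsB (tendsB (tn _ _ lw) (tn _ _ lz))
    (tendsM (tends_cst (w - z)) (tn _ _ lz'))) => m nm.
  by have [_ _ /(_ w wr)[_ f1]] := fT n (m - n)%N z zr; rewrite subnKC in f1.
Qed.

End Ctl.

(** * The complex exponential and logarithm *)

Section Exponential.
Context {R : realType}.
Local Open Scope complex_scope.
Local Notation C := R[i].
Implicit Types (r b c : R) (f g : C -> C).

(** Each multiplication costs the factor 3 of [ctlM]. *)
Lemma ctlX r f f' b n : 0 <= r -> ctl r f f' b ->
  ctl r (fun z => f z ^+ n) (fun z => (f z ^+ n.-1 * f' z) *+ n) ((3 * b) ^+ n).
Proof.
move=> r0 fb; have b0 := ctl_ge0 r0 fb; elim: n => [|n IH].
  by have := @ctl_cst _ r 1; rewrite rnorm1; apply: ctl_eq.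
rewrite [(3 * b) ^+ _]exprS; apply: ctl_eq (ctlM fb IH) => z _; first by rewrite exprS.
case: n {IH} => [|n]; first by rewrite mulr0n mulr0 addr0 expr0 mulr1 mul1r mulr1n.
rewrite /= [f z * _]mulrnAr [f z * _]mulrA -exprS [f' z * _]mulrC.
by rewrite [in RHS]mulrS.
Qed.

Lemma ctl_sum r n (f f' : nat -> C -> C) (b : nat -> R) :
  (forall k, ctl r (f k) (f' k) (b k)) ->
  ctl r (fun z => \sum_(k < n) f k z) (fun z => \sum_(k < n) f' k z)
    (\sum_(k < n) b k).
Proof.
move=> fb; elim: n => [|n IH].
  rewrite big_ord0; have := @ctl_cst _ r 0; rewrite rnorm0.
  by apply: ctl_eq => z _; rewrite big_ord0.
rewrite big_ord_recr/=; apply: ctl_eq (ctlD IH (fb n)) => z _;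
by rewrite big_ord_recr.
Qed.

Lemma half_lt (K e : R) : 0 < e -> exists n, K * 2^-1 ^+ n < e.
Proof.
(* This [n] satisfies |K| / e < n + 1 <= 2^n. *)
move=> e0; exists (Num.truncn (`|K| / e)); set n := Num.truncn _.
have nK : `|K| / e < n.+1%:R by rewrite truncnS_gt.
rewrite exprVn ltr_pdivrMr ?exprn_gt0// mulrC -ltr_pdivrMr//.
apply: (@le_lt_trans _ _ (`|K| / e)); first by rewrite ler_wpM2r ?invr_ge0 ?(ltW e0) ?ler_norm.
by apply: (lt_le_trans nK); rewrite -natrX ler_nat ltn_expl.
Qed.

Lemma tail_half (K : R) : 0 <= K ->
  tail_bound (fun n => K * 2^-1 ^+ n) (fun n => 2 * K * 2^-1 ^+ n).
Proof.
move=> K0; split=> [n|n|e /(@half_lt (2 * K))//].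
  by rewrite !mulr_ge0// exprn_ge0.
rewrite exprS; have : 0 <= K * 2^-1 ^+ n by rewrite mulr_ge0// exprn_ge0.
lra.
Qed.

Lemma tail_series (t : nat -> R) : (forall n, 0 <= t n) -> cvgn (series t) ->
  tail_bound t (fun n => limn (series t) - series t n).
Proof.
move=> t0 tc; split=> [n|n|e e0].
- by rewrite subr_ge0; apply: nondecreasing_cvgn_le => //; apply: nondecreasing_series.
- by rewrite seriesEnat /= [in leLHS]big_nat_recr//=; lra.
- move: tc => /cvgrPdist_lt/(_ e e0)[n _ /(_ n (leqnn n))]/= tn.
  exists n; apply: le_lt_trans tn; exact: ler_norm.
Qed.

Lemma tends_shift (f : nat -> C) l N : tends (fun n => f (N + n)%N) l <-> tends f l.
Proof.
split=> fl e e0; have [M Mf] := fl e e0.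
  exists (N + M)%N => n Nn; rewrite -(subnKC (leq_trans (leq_addr M N) Nn)).
  by apply: Mf; rewrite leq_subRL// (leq_trans _ Nn)// leq_addr.
by exists M => n Mn; apply: Mf; rewrite (leq_trans Mn)// leq_addl.
Qed.

Definition exp_sum (n : nat) (z : C) : C := \sum_(k < n) z ^+ k / k`!%:R.
Definition cexp (z : C) : C := limC (exp_sum ^~ z).

(** Differentiating termwise turns the partial sum of index n + 1 into that of index n, so the
    exponential is its own derivative. *)
Lemma ctl_cexp r : 0 <= r -> exists2 K, 0 <= K & ctl r cexp cexp K.
Proof.
move=> r0; pose es' n (z : C) := \sum_(k < n) (z ^+ k.-1 *+ k / k`!%:R).
have es'S n z : es' n.+1 z = exp_sum n z.
  rewrite /es' big_ord_recl mulr0n mul0r add0r; apply: eq_bigr => k _.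
  rewrite /= factS natrM invfM mulrA -[_ *+ _]mulr_natr mulfK//.
  by rewrite pnatr_eq0.
(* The bound of [ctlX] on z^n / n!: a term of the real exponential series at 3 (r + 1). *)
pose t n := (3 * (r + 1)) ^+ n / n`!%:R.
have t0 n : 0 <= t n by rewrite divr_ge0// exprn_ge0//; lra.
have tc : cvgn (series t) by apply: is_cvg_series_exp_coeff.
have [|lim1 lim2] := ctl_lim (f := exp_sum) (f' := es') r0 _ (tail_series t0 tc).
  move=> n; have := ctlZ (n`!%:R^-1) (ctlX n r0 (ctl_id r0)).
  have -> : rnorm (n`!%:R^-1 : C) = n`!%:R^-1.
    by rewrite rnormV -(rmorph_nat (real_complex R)) rnorm_real ger0_norm.
  rewrite mulrC; apply: ctl_eq => z _.
    by rewrite /exp_sum big_ord_recr/= addrAC subrr add0r mulrC.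
  by rewrite /es' big_ord_recr/= addrAC subrr add0r mulrC mulr1.
exists (limn (series t) - series t 0%N).
  by case: (tail_series t0 tc) => + _ _; apply.
apply: ctl_eq (lim1 0%N) => z zr; first by rewrite /exp_sum big_ord0 subr0.
rewrite /es' big_ord0 subr0; apply: limCE.
apply/(tends_shift _ _ 1); rewrite /=; have [zl _] := lim2 z zr.
by apply: (tends_near (N := 0%N) _ zl) => n _; rewrite add1n; exact: es'S.
Qed.

Lemma cexp0 : cexp 0 = 1.
Proof.
apply: limCE; apply: (tends_near (N := 1%N) _ (tends_cst 1)) => -[//|n] _.
rewrite /exp_sum big_ord_recl expr0 divr1 big1 ?addr0// => k _.
by rewrite /= exprS !mul0r.
Qed.

(** For fixed c the left-hand side has zero derivative in z, hence keeps its value at z = 0. *)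
Lemma cexp_sub (z c : C) : cexp z * cexp (c - z) = cexp c.
Proof.
have r0 := rnorm_ge0 z; have [K K0 ce] := ctl_cexp r0.
have hb := ctlB (@ctl_cst _ (rnorm z) c) (ctl_id r0).
have b0 := ctl_ge0 r0 hb; have [L L0 cb] := ctl_cexp b0.
(* [ctl_comp] controls [cexp (c - z) - cexp 0]; the second summand [ce] restores the subtracted
   term, as [cexp 0 = 1]. *)
have := ctlD (ctlM ce (ctl_comp b0 (lexx _) cb hb)) ce.
set B := (X in ctl _ _ _ X) => gB.
suff /ctl_derivative0_cst/(_ z (lexx _)) :
    ctl (rnorm z) (fun z => cexp z * cexp (c - z)) (fun=> 0) B.
  by rewrite cexp0 mul1r subr0.
by apply: ctl_eq gB => w _; rewrite /= ?cexp0; ring.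
Qed.

Lemma cexpD (a b : C) : cexp (a + b) = cexp a * cexp b.
Proof. by rewrite -(cexp_sub a (a + b)) addrAC subrr add0r. Qed.

Lemma cexp_neq0 (z : C) : cexp z != 0.
Proof.
apply/eqP => z0; have := cexp_sub z 0; rewrite z0 mul0r cexp0 => /esym/eqP.
by rewrite oner_eq0.
Qed.

(** Taylor polynomial of degree n of - ln (1 - z / a), the exponent in the elementary factors. *)
Definition logsum (a : C) (n : nat) (z : C) : C :=
  \sum_(k < n) k.+1%:R^-1 * (z / a) ^+ k.+1.
Definition logsum' (a : C) (n : nat) (z : C) : C :=
  \sum_(k < n) (z / a) ^+ k / a.

Lemma ctl_scale r (a : C) : 0 <= r ->
  ctl r (fun z => z / a) (fun=> a^-1) ((r + 1) / rnorm a).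
Proof.
move=> r0; rewrite mulrC -rnormV; apply: ctl_eq (ctlZ a^-1 (ctl_id r0)) => z _.
  by rewrite mulrC.
by rewrite mulr1.
Qed.

Lemma ctl_logterm r (a : C) k : 0 <= r ->
  ctl r (fun z => k.+1%:R^-1 * (z / a) ^+ k.+1) (fun z => (z / a) ^+ k / a)
    ((3 * ((r + 1) / rnorm a)) ^+ k.+1).
Proof.
move=> r0; have := ctlZ (k.+1%:R^-1) (ctlX k.+1 r0 (ctl_scale a r0)).
have -> : rnorm (k.+1%:R^-1 : C) = k.+1%:R^-1.
  by rewrite rnormV -(rmorph_nat (real_complex R)) rnorm_real ger0_norm.
move=> h; apply: (@ctl_le _ r _ _ _ (k.+1%:R^-1 * (3 * ((r + 1) / rnorm a)) ^+ k.+1)) => //.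
  rewrite ler_piMl ?exprn_ge0 ?mulr_ge0 ?invr_ge0 ?rnorm_ge0//; first by lra.
  by rewrite invf_le1// ler1n.
apply: ctl_eq h => z _ //=.
by rewrite -[_ / a *+ _]mulr_natl mulKf// pnatr_eq0.
Qed.

Lemma ctl_logsum r (a : C) n : 0 <= r -> exists2 b, 0 <= b &
  ctl r (logsum a n) (logsum' a n) b.
Proof.
move=> r0; have h := ctl_sum n (fun k => ctl_logterm a k r0).
by eexists; [exact: ctl_ge0 h|exact: h].
Qed.

(* [logsum a n] tends to [- ln (1 - z / a)] *)
Lemma logsum_log r (a : C) : 0 <= r -> 6 * (r + 1) <= rnorm a ->
  exists L L' : C -> C,
  [/\ forall n, ctl r (fun z => L z - logsum a n z) (fun z => L' z - logsum' a n z)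
        (2^-1 ^+ n),
      forall z, rnorm z <= r -> (1 - z / a) * L' z = a^-1 &
      forall z, rnorm z <= r -> (1 - z / a) * cexp (L z) = 1].
Proof.
move=> r0 ra; have a0 : 0 < rnorm a by lra.
(* The constant 6 is chosen so that the k-th term is controlled by 2^-(k+1). *)
have q2 : 3 * ((r + 1) / rnorm a) <= 2^-1.
  by rewrite mulrA ler_pdivrMr//; lra.
have q0 : 0 <= 3 * ((r + 1) / rnorm a).
  by rewrite mulr_ge0// divr_ge0//; lra.
have h0 : 0 <= 2^-1 :> R by rewrite invr_ge0.
have step n : ctl r (fun z => logsum a n.+1 z - logsum a n z)
    (fun z => logsum' a n.+1 z - logsum' a n z) (2^-1 * 2^-1 ^+ n).
  apply: (@ctl_le _ r _ _ _ ((3 * ((r + 1) / rnorm a)) ^+ n.+1)) => //.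
    by rewrite -exprS lerXn2r// nnegrE; lra.
  by apply: ctl_eq (ctl_logterm a n r0) => z _;
    rewrite /logsum /logsum' big_ord_recr/= addrAC subrr add0r.
have [lim1 lim2] := ctl_lim r0 step (tail_half h0).
set L := fun z => limC (logsum a ^~ z); set L' := fun z => limC (logsum' a ^~ z).
have Ln n : ctl r (fun z => L z - logsum a n z) (fun z => L' z - logsum' a n z)
    (2^-1 ^+ n).
  by have := lim1 n; rewrite mulfV// mul1r.
(* [L'] is the sum of the geometric series with first term 1 / a and ratio z / a. *)
have L'E z : rnorm z <= r -> (1 - z / a) * L' z = a^-1.
  move=> zr; have [_ zl] := lim2 z zr.
  have := tendsM (tends_cst (1 - z / a)) zl.
  move/tends_uniq; apply.
  have wn : tends (fun n => (z / a) ^+ n) 0.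
    move=> e /(@half_lt 1)[N Ne]; exists N => n Nn.
    rewrite subr0; apply: le_lt_trans Ne; rewrite mul1r.
    have w2 : rnorm (z / a) <= 2^-1.
      by rewrite rnormM rnormV ler_pdivrMr//; lra.
    have -> : rnorm ((z / a) ^+ n) = rnorm (z / a) ^+ n.
      elim: n {Nn} => [|n IH]; first by rewrite !expr0 rnorm1.
      by rewrite !exprS rnormM IH.
    apply: (@le_trans _ _ (2^-1 ^+ n)).
      by rewrite lerXn2r// nnegrE ?rnorm_ge0.
    by rewrite ler_wiXn2l//; lra.
  have := tendsM (tendsB (tends_cst 1) wn) (tends_cst a^-1).
  rewrite subr0 mul1r; apply: (tends_near (N := 0%N)) => n _.
  rewrite /logsum' -mulr_suml mulrA; congr (_ * _).
  by rewrite -[LHS]opprK -mulNr opprB -subrX1 opprB.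
exists L, L'; split=> // z zr.
have [K K0 cK] := @ctl_cexp 1 ler01.
have L0n := Ln 0%N.
(* The case n = 0, where the partial sum is empty: [L] maps the disk into the unit disk. *)
have LL : ctl r L L' 1.
  by apply: ctl_eq (Ln 0%N) => w _; rewrite /logsum /logsum' big_ord0 subr0.
have hc := ctl_comp ler01 (lexx _) cK LL.
have ha := ctlB (@ctl_cst _ r 1) (ctl_scale a r0).
(* As in [cexp_sub], the added summand makes up for the subtracted [cexp 0]; the derivative then
   vanishes by [L'E]. *)
have := ctlD (ctlM ha hc) ha; set B := (X in ctl _ _ _ X) => gB.
suff /ctl_derivative0_cst/(_ z zr) -> :
    ctl r (fun z => (1 - z / a) * cexp (L z)) (fun=> 0) B.
  have -> : L 0 = 0.
    apply: limCE; apply: (tends_near (N := 0%N) _ (tends_cst 0)) => n _.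
    by rewrite /logsum big1// => k _; rewrite mul0r exprS mul0r mulr0.
  by rewrite cexp0 mul0r subr0 mul1r.
apply: ctl_eq gB => w wr; rewrite /= ?cexp0; first by ring.
have -> : (0 - a^-1) * (cexp (L w) - 1) + (1 - w / a) * (L' w * cexp (L w)) +
  (0 - a^-1) = cexp (L w) * ((1 - w / a) * L' w - a^-1) by ring.
by rewrite L'E// subrr mulr0.
Qed.

End Exponential.

(** * Weierstrass products *)

Section Weierstrass.
Context {R : realType}.
Local Open Scope complex_scope.
Local Notation C := R[i].
Implicit Types (r b c : R) (f g : C -> C).

Definition ctl_entire (f f' : C -> C) := forall r, 0 <= r -> exists b, ctl r f f' b.

(** On each disk finitely many factors are left free, since they may vanish there; the others
    approach 1 geometrically. *)
Definition ctl_factors (e e' : nat -> C -> C) :=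
  (forall j, ctl_entire (e j) (e' j)) /\
  (forall r, 0 <= r -> exists N K, 0 <= K /\ forall j, (N <= j)%N ->
    ctl r (fun z => e j z - 1) (e' j) (K * 2^-1 ^+ j)).

Definition pprod (e : nat -> C -> C) n (z : C) : C := \prod_(j < n) e j z.
Definition iprod e (z : C) : C := limC (pprod e ^~ z).

Fixpoint pprod' (e e' : nat -> C -> C) n (z : C) : C :=
  if n is m.+1 then pprod' e e' m z * e m z + pprod e m z * e' m z else 0.

Lemma pprodS e n z : pprod e n.+1 z = pprod e n z * e n z.
Proof. by rewrite /pprod big_ord_recr. Qed.

Lemma ctl_pprod e e' n : ctl_factors e e' -> ctl_entire (pprod e n) (pprod' e e' n).
Proof.
move=> [ee _] r r0; elim: n => [|n [b IH]].
  eexists; apply: ctl_eq (@ctl_cst _ r 1) => z _ //.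
  by rewrite /pprod big_ord0.
have [c ec] := ee n r r0; exists (3 * b * c).
by apply: ctl_eq (ctlM IH ec) => z _; rewrite ?pprodS.
Qed.

(** Past [N] the partial products keep a common bound [M], so their increments P (e - 1) are
    geometrically small and [ctl_lim] applies. *)
Lemma ctl_iprod e e' : ctl_factors e e' ->
  ctl_entire (iprod e) (fun z => limC (pprod' e e' ^~ z)) /\
  (forall z, tends (pprod e ^~ z) (iprod e z)).
Proof.
move=> he; suff H r : 0 <= r ->
    (exists b, ctl r (iprod e) (fun z => limC (pprod' e e' ^~ z)) b) /\
    (forall z, rnorm z <= r -> tends (pprod e ^~ z) (iprod e z)).
  by split=> [r /H[]//|z]; have [_] := H _ (rnorm_ge0 z); apply.
move=> r0; have [_ /(_ r r0)[N [K [K0 eK]]]] := he.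
have [b pb] := ctl_pprod N he r0; have b0 := ctl_ge0 r0 pb.
have half0 k : 0 <= 2^-1 ^+ k :> R by rewrite exprn_ge0.
have halfS k : 2^-1 ^+ k = 2 * 2^-1 ^+ k.+1 :> R by rewrite exprS; lra.
have KN k : K * 2^-1 ^+ (N + k) <= K * 2^-1 ^+ k.
  by rewrite ler_wpM2l// ler_wiXn2l ?leq_addl//; lra.
(* The exponent is the sum of 3 K 2^-j over j < k. *)
have pk k : ctl r (pprod e (N + k)) (pprod' e e' (N + k))
    (b * expR (6 * K * (1 - 2^-1 ^+ k))).
  elim: k => [|k IH]; first by rewrite addn0 expr0 subrr mulr0 expR0 mulr1.
  set B := b * _ in IH; have B0 := ctl_ge0 r0 IH.
  (* Writing P e = P (e - 1) + P multiplies the bound by 1 + 3 K 2^-(N+k), which is at most exp (3 K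
     2^-k). *)
  have step := ctlD (ctlM IH (eK (N + k)%N (leq_addr _ _))) IH.
  rewrite addnS; apply: ctl_le (lexx _) _ (ctl_eq _ _ step).
  - have -> : b * expR (6 * K * (1 - 2^-1 ^+ k.+1)) = B * expR (3 * K * 2^-1 ^+ k).
      rewrite /B -[RHS]mulrA -expRD; congr (_ * expR _).
      by rewrite (halfS k); ring.
    have := ler_wpM2l B0 (expR_ge1Dx (3 * K * 2^-1 ^+ k)).
    have := ler_wpM2l B0 (KN k); lra.
  - by move=> z _; rewrite pprodS; ring.
  - by move=> z _; rewrite /=; ring.
set M := b * expR (6 * K).
have M0 : 0 <= M by rewrite mulr_ge0// expR_ge0.
have pM k : ctl r (pprod e (N + k)) (pprod' e e' (N + k)) M.
  apply: ctl_le (lexx _) _ (pk k); rewrite ler_wpM2l// ler_expR.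
  by have := mulr_ge0 K0 (half0 k); lra.
have step k : ctl r (fun z => pprod e (N + k.+1) z - pprod e (N + k) z)
   (fun z => pprod' e e' (N + k.+1) z - pprod' e e' (N + k) z) (3 * M * K * 2^-1 ^+ k).
  rewrite addnS; have := ctlM (pM k) (eK (N + k)%N (leq_addr _ _)).
  move/(ctl_le (lexx r) (_ : 3 * M * (K * 2^-1 ^+ (N + k)) <= 3 * M * K * 2^-1 ^+ k)).
  have -> : 3 * M * (K * 2^-1 ^+ (N + k)) <= 3 * M * K * 2^-1 ^+ k.
    by rewrite -[leRHS]mulrA ler_wpM2l// mulr_ge0.
  by move/(_ isT); apply: ctl_eq => z _; rewrite /= ?pprodS; ring.
have MK0 : 0 <= 3 * M * K by rewrite !mulr_ge0.
have [lim1 lim2] := ctl_lim (f := fun k => pprod e (N + k))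
  (f' := fun k => pprod' e e' (N + k)) r0 step (tail_half MK0).
have limE (F : nat -> C) l : tends (fun k => F (N + k)%N) l -> limC F = l.
  by move=> /tends_shift; apply: limCE.
split; last first.
  by move=> z /lim2[zl _]; apply: limC_tends; eexists; apply/tends_shift; exact: zl.
exists (2 * (3 * M * K) * 2^-1 ^+ 0 + M).
apply: ctl_eq (ctlD (lim1 0%N) (pM 0%N)) => z zr; have [l1 l2] := lim2 z zr;
  by rewrite subrK; apply/esym/limE.
Qed.

(** A product of factors 1 - d_j is at least 1 minus the sum of the d_j. From a late index on this
    sum is below 1/2, so the limit keeps half of a nonzero partial product. *)
Lemma iprod_neq0 e e' z : ctl_factors e e' -> (forall j, e j z != 0) ->
  iprod e z != 0.
Proof.
move=> he ez; have [_ lz] := ctl_iprod he.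
have [_ /(_ _ (rnorm_ge0 z))[N [K [K0 eK]]]] := he.
have half0 k : 0 <= 2^-1 ^+ k :> R by rewrite exprn_ge0.
have [m0 mK] : exists m, 2 * K * 2^-1 ^+ m < 2^-1 by apply: half_lt; rewrite invr_gt0.
pose m := maxn N m0.
have mK2 : 2 * K * 2^-1 ^+ m < 2^-1.
  apply: le_lt_trans mK; rewrite ler_wpM2l ?mulr_ge0// ler_wiXn2l ?leq_maxr//; lra.
have pm0 : 0 < rnorm (pprod e m z).
  by rewrite rnorm_gt0; apply/prodf_neq0 => j _; exact: ez.
(* The subtracted quantity is the sum of K 2^-j over m <= j < m + k. *)
have pk k : rnorm (pprod e m z) * (1 - 2 * K * 2^-1 ^+ m * (1 - 2^-1 ^+ k)) <=
    rnorm (pprod e (m + k) z).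
  elim: k => [|k IH]; first by rewrite addn0 expr0 subrr mulr0 subr0 mulr1.
  rewrite addnS pprodS rnormM.
  have [|+ _ _] := eK (m + k)%N _ z (lexx _).
    by rewrite (leq_trans (leq_maxl N m0))// leq_addr.
  rewrite exprD mulrA; have := rnormD (1 - e (m + k)%N z) (e (m + k)%N z).
  rewrite subrK rnorm1 rdistC => e1 e2.
  set D := K * 2^-1 ^+ m in e2 *; have D0 : 0 <= D by rewrite mulr_ge0.
  have D2 : D < 2^-1 by rewrite /D in D0 *; lra.
  have hk0 := half0 k; have hk1 : 2^-1 ^+ k <= 1 :> R.
    by rewrite exprn_ile1// invf_le1// ler1n.
  rewrite exprS; set h := 2^-1 ^+ k in IH e2 hk0 hk1 *.
  have Dh : 0 <= D * h by rewrite mulr_ge0.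
  have Dh1 : D * h <= D by rewrite ler_piMr.
  have e3 : 1 - D * h <= rnorm (e (m + k)%N z) by lra.
  have A0 : 0 <= 1 - D * h by lra.
  have KD : 2 * K * 2^-1 ^+ m = 2 * D by rewrite /D mulrA.
  rewrite KD in IH *.
  have B0 : 0 <= rnorm (pprod e m z) * (1 - 2 * D * (1 - h)).
    by rewrite mulr_ge0 ?rnorm_ge0//; lra.
  apply: (le_trans _ (ler_pM B0 A0 IH e3)).
  rewrite -[leRHS]mulrA ler_wpM2l ?rnorm_ge0//.
  by have := mulr_ge0 (mulr_ge0 D0 Dh) (_ : 0 <= 1 - h); rewrite subr_ge0 => /(_ hk1); lra.
rewrite -rnorm_gt0; apply: (@lt_le_trans _ _ (rnorm (pprod e m z) * 2^-1)).
  by rewrite mulr_gt0.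
apply: (tends_lb (N := m)) (lz z) => n mn; rewrite -(subnKC mn).
apply: le_trans (pk _); rewrite ler_wpM2l ?rnorm_ge0//.
have hm := half0 m; have hk := half0 (n - m)%N.
have := mulr_ge0 (mulr_ge0 K0 hm) hk; lra.
Qed.

(** Replacing a factor by 1 removes it without reindexing; beyond n the partial products differ
    exactly by [e n z]. *)
Lemma iprod_split e e1 n : (forall j, j != n -> e1 j = e j) ->
  (forall z, e1 n z = 1) -> (forall z, tends (pprod e1 ^~ z) (iprod e1 z)) ->
  forall z, iprod e z = e n z * iprod e1 z.
Proof.
move=> e1E e1n lz z; apply: limCE.
apply: (tends_near (N := n.+1)) (tendsM (tends_cst (e n z)) (lz z)) => m nm.
rewrite /pprod (bigD1 (Ordinal nm))//= [in RHS](bigD1 (Ordinal nm))//= e1n mul1r.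
by congr (_ * _); apply: eq_bigr => j jn; rewrite e1E.
Qed.

(* the nonvanishing part of the elementary factor of genus [n] with zero [a] *)
Definition efac (a : C) n (z : C) : C :=
  if a == 0 then 1 else - a^-1 * cexp (logsum a n z).
Definition efac' (a : C) n (z : C) : C :=
  if a == 0 then 0 else - a^-1 * (logsum' a n z * cexp (logsum a n z)).

Lemma efac_neq0 a n z : efac a n z != 0.
Proof.
rewrite /efac; case: (eqVneq a 0) => [_|a0]; first exact: oner_neq0.
by rewrite mulf_neq0 ?cexp_neq0// oppr_eq0 invr_eq0.
Qed.

Lemma ctl_efac a n : ctl_entire (efac a n) (efac' a n).
Proof.
move=> r r0; rewrite /efac /efac'; case: (eqVneq a 0) => [_|a0].
  by eexists; exact: ctl_cst.
have [b b0 hb] := ctl_logsum a n r0; have [K K0 cK] := ctl_cexp b0.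
eexists; apply: ctl_eq (ctlZ (- a^-1) (ctlD (ctl_comp b0 (lexx _) cK hb) (@ctl_cst _ r 1))) => z _.
  by rewrite /= cexp0 subrK.
by rewrite addr0.
Qed.

Lemma ctl_entireM f f' g g' : ctl_entire f f' -> ctl_entire g g' ->
  ctl_entire (fun z => f z * g z) (fun z => f' z * g z + f z * g' z).
Proof.
move=> fe ge r r0; have [b fb] := fe r r0; have [c gc] := ge r r0.
by eexists; exact: ctlM fb gc.
Qed.

Lemma ctl_entire_sub a : ctl_entire (fun z => z - a) (fun=> 1).
Proof.
move=> r r0; eexists; apply: ctl_eq (ctlB (ctl_id r0) (@ctl_cst _ r a)) => z _ //.
by rewrite subr0.
Qed.

(** The product is (1 - z / a) exp (logsum), that is exp (logsum - L), because (1 - z / a) exp L =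
    1. Its exponent is controlled by 2^-n, and [ctl_comp] transfers this to the distance from 1. *)
Lemma ctl_elementary : exists2 K : R, 0 <= K & forall r (a : C) n, 0 <= r ->
  6 * (r + 1) <= rnorm a ->
  ctl r (fun z => (z - a) * efac a n z - 1)
    (fun z => 1 * efac a n z + (z - a) * efac' a n z) (K * 2^-1 ^+ n).
Proof.
have [K K0 cK] := @ctl_cexp R 1 ler01; exists (2 * K); first lra.
move=> r a n r0 ra; have a0 : 0 < rnorm a by lra.
have a1 : a != 0 by rewrite -rnorm_gt0.
have [L [L' [LN L'E LE]]] := logsum_log r0 ra.
have := LN n; move/(ctlZ (-1)); rewrite rnormN rnorm1 mul1r.
have h0 : 0 <= 2^-1 ^+ n :> R by rewrite exprn_ge0.
have h1 : 2^-1 ^+ n <= 1 :> R by rewrite exprn_ile1// invf_le1// ler1n.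
have h2 : (2^-1 ^+ n) ^+ 2 <= 2^-1 ^+ n :> R by rewrite expr2 ler_piMr.
move/(ctl_comp ler01 h1 cK).
move/(ctl_le (lexx r) (_ : _ <= 2 * K * 2^-1 ^+ n)).
have -> : K * (2^-1 ^+ n + (2^-1 ^+ n) ^+ 2) <= 2 * K * 2^-1 ^+ n.
  by have := ler_wpM2l K0 h2; lra.
move/(_ isT); apply: ctl_eq => z zr.
all: have eE : cexp (-1 * (L z - logsum a n z)) = (z - a) * efac a n z.
  1, 3: rewrite /efac (negbTE a1) mulN1r opprB.
  1, 2: apply: (mulIf (cexp_neq0 (L z))); rewrite -cexpD subrK.
  1, 2: rewrite -[LHS]mulr1 -(LE z zr); field; exact: a1.
- by rewrite eE cexp0.
rewrite eE mulN1r opprB /efac /efac' (negbTE a1).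
set c := cexp _; set l := logsum' a n z.
have -> : (l - L' z) * ((z - a) * (- a^-1 * c)) =
  (l * ((1 - z / a)) - (1 - z / a) * L' z) * c by field.
by rewrite L'E//; field.
Qed.

(** The j-th factor gets genus j, so on each disk [ctl_elementary] applies to all but finitely many
    j. The cofactors [q n] are returned too: they express simplicity of the zeros. *)
Theorem weierstrass (zs : nat -> C) :
  (forall r : R, exists N, forall n, (N <= n)%N -> r <= rnorm (zs n)) ->
  exists (Q Q' : C -> C) (q q' : nat -> C -> C),
  [/\ ctl_entire Q Q', forall n, ctl_entire (q n) (q' n),
      forall n z, Q z = (z - zs n) * q n z &
      forall n z, q n z = 0 -> exists2 m, m != n & z = zs m].
Proof.
move=> zsoo.
pose e j z := (z - zs j) * efac (zs j) j z.
pose e' j z := 1 * efac (zs j) j z + (z - zs j) * efac' (zs j) j z.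
(* The product with its n-th factor removed; it yields [q n]. *)
pose e1 n j z : C := if j == n then 1 else e j z.
pose e1' n j z : C := if j == n then 0 else e' j z.
have ee j : ctl_entire (e j) (e' j).
  exact: ctl_entireM (ctl_entire_sub _) (ctl_efac _ _).
have [K K0 eK] := ctl_elementary.
have he : ctl_factors e e'.
  split=> // r r0; have [N Nz] := zsoo (6 * (r + 1)); exists N, K; split=> // j /Nz.
  exact: eK.
have he1 n : ctl_factors (e1 n) (e1' n).
  split=> [j r r0|r r0].
    have [b eb] := ee j r r0; rewrite /e1 /e1'; case: eqP => // _; last by exists b.
    by eexists; exact: ctl_cst.
  have [N Nz] := zsoo (6 * (r + 1)); exists N, K; split=> // j /Nz zj.
  rewrite /e1 /e1'; case: eqP => _; last exact: eK.
  have := @ctl_cst _ r (0 : C); rewrite rnorm0.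
  move/(ctl_le (lexx r) (_ : 0 <= K * 2^-1 ^+ j)); rewrite mulr_ge0 ?exprn_ge0//.
  by move/(_ isT); apply: ctl_eq => z _; rewrite ?subrr.
have [Q1 _] := ctl_iprod he.
have q1 n := ctl_iprod (he1 n).
exists (iprod e); eexists; exists (fun n z => efac (zs n) n z * iprod (e1 n) z).
exists (fun n z => efac' (zs n) n z * iprod (e1 n) z +
   efac (zs n) n z * limC (pprod' (e1 n) (e1' n) ^~ z)).
split; first exact: Q1.
- by move=> n; apply: ctl_entireM (ctl_efac _ _) (q1 n).1.
- move=> n z; rewrite mulrA -/(e n z); apply: iprod_split => [j /negbTE jn|w|].
  + by rewrite /e1 jn.
  + by rewrite /e1 eqxx.
  + exact: (q1 n).2.
move=> n z /eqP; rewrite mulf_eq0 (negbTE (efac_neq0 _ _ _))/= => q0.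
(* If z is none of the other nodes, no remaining factor vanishes at z, and neither does their
   product. *)
apply: contrapT => nz; suff : iprod (e1 n) z != 0 by rewrite q0.
apply: (@iprod_neq0 _ _ z (he1 n)) => j.
rewrite /e1; case: (eqVneq j n) => [_|jn]; first exact: oner_neq0.
rewrite mulf_neq0 ?efac_neq0// subr_eq0; apply/eqP => zj; apply: nz.
by exists j.
Qed.

End Weierstrass.

(** * Complex derivatives *)

Section ComplexDerivative.
Context {R : realType}.
Local Open Scope complex_scope.
Local Notation C := R[i].
Implicit Types (W : normedModType R[i]).

(** Division-free derivative with real epsilons; the point w = z is allowed. *)
Definition cdiff W (f : C -> W) (z : C) (d : W) := forall e : R, 0 < e ->
  exists2 dl : R, 0 < dl & forall w : C, rnorm (w - z) < dl ->
    rnorm (f w - f z - (w - z) *: d) <= e * rnorm (w - z).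

Lemma near_dnbhs0 (P : C -> Prop) :
  (\forall h \near (0 : R[i]^o)^', P h) <->
  exists2 dl : R, 0 < dl & forall h : C, h != 0 -> rnorm h < dl -> P h.
Proof.
split=> [/nbhs_ballP[e /= /eps_real[d d0 ->] dP]|[d d0 dP]].
  exists d => // h h0 hd; apply: dP => //.
  by rewrite -ball_normE /ball_/= sub0r normrN rnormE ltcR.
apply/nbhs_ballP; exists d%:C; first by rewrite /= ltcR.
move=> h; rewrite -ball_normE /ball_/= sub0r normrN rnormE ltcR => hd h0.
exact: dP.
Qed.

Lemma cdiff_quotient W (f : C -> W) z d : cdiff f z d <->
  h^-1 *: ((f \o shift z) (h *: (1 : R[i]^o)) - f z) @[h --> (0 : R[i]^o)^'] --> d.
Proof.
have E (h : C) : h != 0 -> rnorm (d - h^-1 *: ((f \o shift z) (h *: (1 : R[i]^o)) - f z)) =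
    (rnorm h)^-1 * rnorm (f (z + h) - f z - h *: d).
  move=> h0; rewrite rdistC -rnormV -rnormZ [in RHS]scalerBr scalerA mulVf// scale1r.
  have h1 : h *: (1 : R[i]^o) = h := mulr1 h.
  by rewrite /= h1 [z + h]addrC.
split=> [fd|/cvgrPdist_le fd e e0].
  apply/cvgrPdist_le => e /eps_real[r r0 ->]; have [dl dl0 fdl] := fd r r0.
  apply/near_dnbhs0; exists dl => // h h0 hd; rewrite rnormE lecR E//.
  rewrite ler_pdivrMl ?rnorm_gt0// mulrC.
  by have := fdl (z + h); rewrite addrAC subrr add0r; apply.
have /fd/near_dnbhs0[dl dl0 fdl] : 0 < e%:C by rewrite ltcR.
exists dl => // w wz; have [->|wz0] := eqVneq w z.
  by rewrite !subrr scale0r subr0 !rnorm0 mulr0.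
have wz1 : w - z != 0 by rewrite subr_eq0.
have := fdl _ wz1 wz; rewrite rnormE lecR E// ler_pdivrMl ?rnorm_gt0//.
by rewrite [z + _]addrC subrK mulrC.
Qed.

Lemma cdiff_derivable W (f : C -> W) z d : cdiff f z d ->
  derivable (f : R[i]^o -> W) (z : R[i]^o) 1 /\ cderiv f z = d.
Proof.
move=> /cdiff_quotient fd; split; first by apply/cvg_ex; exists d.
exact: cvg_lim fd.
Qed.

Lemma derivable_cdiff W (f : C -> W) z :
  derivable (f : R[i]^o -> W) (z : R[i]^o) 1 -> cdiff f z (cderiv f z).
Proof. by move=> fd; apply/cdiff_quotient. Qed.

Lemma cdiff_lip W (f : C -> W) z d : cdiff f z d ->
  exists K, exists2 dl, 0 < dl & forall w, rnorm (w - z) < dl ->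
    rnorm (f w - f z) <= K * rnorm (w - z).
Proof.
move=> /(_ 1 ltr01)[dl dl0 fd]; exists (1 + rnorm d); exists dl => // w /fd.
have := rnormD (f w - f z - (w - z) *: d) ((w - z) *: d).
rewrite subrK rnormZ; lra.
Qed.

Lemma cdiff_neq0 W (f : C -> W) z d : cdiff f z d -> f z != 0 ->
  exists2 dl, 0 < dl & forall w, rnorm (w - z) < dl -> rnorm (f z) / 2 <= rnorm (f w).
Proof.
move=> /cdiff_lip[K [dl dl0 fK]]; rewrite -rnorm_gt0 => fz0.
have K0 : 0 < `|K| + 1 by rewrite ltr_wpDl.
exists (Num.min dl (rnorm (f z) / 2 / (`|K| + 1))); first by rewrite lt_min dl0 !divr_gt0.
move=> w; rewrite lt_min ltr_pdivlMr// => /andP[/fK fw].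
have := rnormD (f z - f w) (f w); rewrite subrK rdistC.
have := rnorm_ge0 (w - z); have := ler_norm K; nra.
Qed.

Lemma ctl_cdiff (f f' : C -> C) z : ctl_entire f f' -> cdiff (f : C -> R[i]^o) z (f' z).
Proof.
(* A radius larger than |z| by 1 leaves room for the points near z. *)
have r1 : 0 <= rnorm z + 1 by rewrite addr_ge0 ?rnorm_ge0.
move=> /(_ _ r1)[b fb]; have b0 := ctl_ge0 r1 fb.
have [|_ _ fz] := fb z; first lra.
move=> e e0; exists (Num.min 1 (e / (b + 1))).
  by rewrite lt_min ltr01 divr_gt0//; lra.
move=> w; rewrite lt_min ltr_pdivlMr; last lra.
move=> /andP[w1 we]; have [|_] := fz w.
  by have := rnormD (w - z) z; rewrite subrK; lra.
move=> /le_trans; apply; have := rnorm_ge0 (w - z); nra.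
Qed.

(** The remainder is (w - z) (g w - g z), quadratic in w - z because g is Lipschitz at z. *)
Lemma cdiff_root W (f g : C -> W) z d : cdiff g z d ->
  (forall w, f w = (w - z) *: g w) -> cdiff f z (g z).
Proof.
move=> /cdiff_lip[K [dl dl0 gK]] fg e e0.
have K0 : 0 < `|K| + 1 by rewrite ltr_wpDl.
exists (Num.min dl (e / (`|K| + 1))); first by rewrite lt_min dl0 !divr_gt0.
move=> w; rewrite lt_min ltr_pdivlMr// => /andP[/gK gw we].
rewrite !fg subrr scale0r subr0 -scalerBr rnormZ.
have := rnorm_ge0 (w - z); have := rnorm_ge0 (g w - g z); have := ler_norm K; nra.
Qed.

(** Quotient rule where differentiability of [a] is a conclusion: [q w] times the remainder of [a]
    is expressed by the remainders of f and q, and |q w| >= |q z| / 2 near z. *)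
Lemma cdiff_div W (q : C -> R[i]^o) q' (f a : C -> W) f' z :
  cdiff q z q' -> cdiff f z f' -> q z != 0 -> (forall w, f w = q w *: a w) ->
  cdiff a z ((q z)^-1 *: (f' - q' *: a z)).
Proof.
move=> qd fd qz fqa e e0; set D := _ *: _.
have [d0 d00 q2] := cdiff_neq0 qd qz; have [K [d1 d10 qK]] := cdiff_lip qd.
have qz0 : 0 < rnorm (q z) by rewrite rnorm_gt0.
(* One summand for each of the three terms in the decomposition below. *)
pose M := 1 + rnorm (a z) + rnorm D * `|K|.
have M0 : 0 < M.
  by rewrite /M -addrA ltr_pwDl// addr_ge0 ?mulr_ge0 ?rnorm_ge0.
pose e1 := e * (rnorm (q z) / 2) / M.
have e10 : 0 < e1 by rewrite divr_gt0// mulr_gt0//; lra.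
have [d2 d20 qe] := qd _ e10; have [d3 d30 fe] := fd _ e10.
exists (Num.min (Num.min d0 d1) (Num.min (Num.min d2 d3) e1)).
  by rewrite !lt_min d00 d10 d20 d30.
move=> w; rewrite !lt_min -!andbA => /and5P[/q2 w0 /qK w1 /qe w2 /fe w3 we].
set h := w - z in w1 w2 w3 we *; have h0 := rnorm_ge0 h.
have qw0 : 0 < rnorm (q w) by lra.
rewrite -(ler_pM2l qw0) -rnormZ.
have -> : q w *: (a w - a z - h *: D) = (f w - f z - h *: f')
    - (q w - q z - h *: q') *: a z - (h * (q w - q z)) *: D.
  have f'E : h *: f' = h *: (q z *: D) + (h * q') *: a z.
    by rewrite /D [q z *: _]scalerA mulfV// scale1r scalerBr -scalerA subrK.
  have azE : q w *: a z = (q w - q z - h *: q') *: a z + f z + (h * q') *: a z.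
    by rewrite fqa -!scalerDl [_ - _ + q z]addrAC !subrK.
  have DE : (q w * h) *: D = (h * (q w - q z)) *: D + h *: (q z *: D).
    by rewrite [h *: _]scalerA -scalerDl -mulrDr subrK mulrC.
  rewrite !scalerBr -fqa azE [q w *: (h *: _)]scalerA DE f'E !opprD !addrA.
  by rewrite [LHS](ACl (1*3*6*4*2*5)).
have aw0 := rnorm_ge0 (a z); have D0 := rnorm_ge0 D.
apply: (le_trans (rnormD _ _)); rewrite rnormN rnormZ rnormM.
apply: (le_trans (lerD (rnormD _ _) (lexx _))); rewrite rnormN rnormZ.
have K0 : rnorm (q w - q z) <= `|K| * rnorm h.
  by apply: le_trans w1 _; rewrite ler_wpM2r// ler_norm.
have e1M : e1 * M = e * (rnorm (q z) / 2) by rewrite /e1 divfK ?gt_eqF.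
apply: (@le_trans _ _ (e1 * M * rnorm h)).
  have := ler_wpM2l D0 (ler_pM h0 (rnorm_ge0 _) (ltW we) K0).
  have := ler_wpM2r aw0 w2; rewrite /M; lra.
rewrite e1M mulrCA mulrAC [leRHS]mulrC -mulrA [leRHS]mulrC.
have := mulr_ge0 (ltW e0) h0; nra.
Qed.

End ComplexDerivative.

(** * Orthonormal expansions *)

Section Orthonormal.
Context {R : realType} {X : completeNormedModType R[i]} {ip : X -> X -> R[i]}.
Context (Hip : is_inner_product ip).
Local Open Scope complex_scope.
Local Notation C := R[i].

Lemma ipDl x y z : ip (x + y) z = ip x z + ip y z.
Proof. by case: Hip => /(_ 1 x y z) + _ _; rewrite scale1r mul1r. Qed.

Lemma ip0l z : ip 0 z = 0.
Proof. by apply: (addrI (ip 0 z)); rewrite -ipDl !addr0. Qed.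

Lemma ipZl (a : C) x z : ip (a *: x) z = a * ip x z.
Proof. by case: Hip => /(_ a x 0 z) + _ _; rewrite ip0l !addr0. Qed.

Lemma ipBl x y z : ip (x - y) z = ip x z - ip y z.
Proof. by rewrite -scaleN1r ipDl ipZl mulN1r. Qed.

Lemma ip_sym0 x y : ip x y = 0 -> ip y x = 0.
Proof. by case: Hip => _ /(_ x y) -> _ ->; rewrite rmorph0. Qed.

Lemma ipxx x : ip x x = (rnorm x ^+ 2)%:C.
Proof. by case: Hip => _ _ /(_ x) ->; rewrite rnormE rmorphXn. Qed.

Lemma pythagoras x y : ip x y = 0 -> rnorm (x + y) ^+ 2 = rnorm x ^+ 2 + rnorm y ^+ 2.
Proof.
move=> xy; suff : ip (x + y) (x + y) = ip x x + ip y y by rewrite !ipxx -rmorphD => -[].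
have conj_ip a b : ip b a = conjc (ip a b) by case: Hip.
by rewrite ipDl conj_ip [X in _ + X]conj_ip !ipDl xy (ip_sym0 xy) addr0 add0r -!conj_ip.
Qed.

Context {u : nat -> X} (Hu : orthonormal_basis ip u).

Definition usum (a : nat -> C) n : X := \sum_(k < n) a k *: u k.
Definition sqsum (a : nat -> C) n : R := \sum_(k < n) rnorm (a k) ^+ 2.

Lemma ip_u k m : ip (u k) (u m) = (k == m)%:R.
Proof. by case: Hu. Qed.

Lemma ip_u_eq0 x : (forall n, ip x (u n) = 0) -> x = 0.
Proof. by case: Hu => _; apply. Qed.

Lemma ip_u_inj x y : (forall n, ip x (u n) = ip y (u n)) -> x = y.
Proof.
by move=> xy; apply/subr0_eq/ip_u_eq0 => n; rewrite ipBl xy subrr.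
Qed.

Lemma usumS a n : usum a n.+1 = usum a n + a n *: u n.
Proof. by rewrite /usum big_ord_recr. Qed.

Lemma ip_usum a n m : ip (usum a n) (u m) = if (m < n)%N then a m else 0.
Proof.
elim: n => [|n IH]; first by rewrite /usum big_ord0 ip0l.
rewrite usumS ipDl ipZl IH ip_u ltnS [(m <= n)%N]leq_eqVlt [n == m]eq_sym.
case: (eqVneq m n) => [->|_] /=; first by rewrite ltnn add0r mulr1.
by rewrite mulr0 addr0.
Qed.

Lemma ip_usum0 a n y : (forall k, (k < n)%N -> ip (u k) y = 0) -> ip (usum a n) y = 0.
Proof.
elim: n => [|n IH] uy; first by rewrite /usum big_ord0 ip0l.
rewrite usumS ipDl ipZl uy// mulr0 addr0 IH// => k kn.
by apply: uy; rewrite ltnS ltnW.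
Qed.

Lemma rnorm_usum a n : rnorm (usum a n) ^+ 2 = sqsum a n.
Proof.
elim: n => [|n IH]; first by rewrite /usum /sqsum !big_ord0 rnorm0 expr0n.
rewrite usumS pythagoras; last first.
  by apply: ip_sym0; rewrite ipZl (ip_sym0 (_ : ip (usum a n) _ = 0)) ?mulr0// ip_usum ltnn.
rewrite IH /sqsum big_ord_recr/= rnormZ exprMn.
have -> : rnorm (u n) ^+ 2 = 1; last by rewrite mulr1.
by have := ip_u n n; rewrite ipxx eqxx => -[].
Qed.

(** The remainder is orthogonal to the first n basis vectors. *)
Lemma bessel x n :
  rnorm (x - usum (fun k => ip x (u k)) n) ^+ 2 = rnorm x ^+ 2 - sqsum (fun k => ip x (u k)) n.
Proof.
set s := usum _ n; have : ip s (x - s) = 0.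
  apply: ip_usum0 => k kn; apply: ip_sym0.
  by rewrite ipBl ip_usum kn subrr.
by move/pythagoras; rewrite addrC subrK => ->; rewrite rnorm_usum addrAC subrr add0r.
Qed.

Lemma rnorm_ip_u x k : rnorm (ip x (u k)) <= rnorm x.
Proof.
rewrite -ler_sqr ?nnegrE ?rnorm_ge0//.
have := sqr_ge0 (rnorm (x - usum (fun k => ip x (u k)) k.+1)).
rewrite bessel subr_ge0; apply: le_trans; rewrite /sqsum big_ord_recr/= lerDr.
by apply: sumr_ge0 => j _; rewrite sqr_ge0.
Qed.

Lemma sqsum_ip_le x n : sqsum (fun k => ip x (u k)) n <= rnorm x ^+ 2.
Proof. by rewrite -subr_ge0 -bessel sqr_ge0. Qed.

(** Squared distances of partial sums are increments of the bounded monotone sequence [sqsum a], so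
    the partial sums are Cauchy. *)
Lemma riesz_fischer a (B : R) : (forall n, sqsum a n <= B) ->
  exists2 w, tends (usum a) w & forall k, ip w (u k) = a k.
Proof.
move=> aB; have aS : nondecreasing_seq (sqsum a).
  by apply/nondecreasing_seqP => n; rewrite /sqsum big_ord_recr/= lerDl sqr_ge0.
have ac : cvgn (sqsum a).
  by apply: nondecreasing_is_cvgn => //; exists B => _ [n _ <-]; exact: aB.
have [|w aw] := @complete_tends _ X (usum a).
  move=> e e0; have e2 : 0 < e ^+ 2 by rewrite exprn_gt0.
  move: (ac) => /cvgrPdist_lt/(_ _ e2)[N _ /(_ N (leqnn N))]/= Ne.
  exists N => n Nn; rewrite -ltr_sqr ?nnegrE ?rnorm_ge0 ?(ltW e0)//.
  (* The shorter sum is the projection of the longer one, so [bessel] computes their distance. *)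
  have -> : usum a N = usum (fun k => ip (usum a n) (u k)) N.
    by apply: eq_bigr => k _; rewrite ip_usum (leq_trans (ltn_ord k) Nn).
  rewrite bessel rnorm_usum; apply: le_lt_trans Ne; apply: le_trans (ler_norm _).
  apply: lerB; first exact: nondecreasing_cvgn_le.
  by apply: ler_sum => k _; rewrite ip_usum (leq_trans (ltn_ord k) Nn).
exists w => // k; apply: (@tends_uniq _ _ (fun n => ip (usum a n) (u k))).
  by apply: (tends_dom (K := 1) (N0 := 0%N) _ aw aw) => n _;
    rewrite -ipBl; have := rnorm_ip_u (usum a n - w) k;
    have := rnorm_ge0 (usum a n - w); lra.
by apply: (tends_near (N := k.+1) _ (tends_cst (a k))) => n kn; rewrite ip_usum kn.
Qed.

(** Riesz-Fischer gives a sum with the coefficients of x, and totality of the basis identifies it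
    with x. *)
Lemma fourier x : tends (usum (fun k => ip x (u k))) x.
Proof.
have [w xw wk] := riesz_fischer (sqsum_ip_le x).
by rewrite -[X in tends _ X](ip_u_inj wk).
Qed.

Lemma riesz_fischer_mul x (m : nat -> C) (M : R) : (forall k, rnorm (m k) <= M) ->
  exists w, forall k, ip w (u k) = ip x (u k) * m k.
Proof.
move=> mM; have [|w _ wk] := @riesz_fischer (fun k => ip x (u k) * m k) (M ^+ 2 * rnorm x ^+ 2).
  move=> n; apply: le_trans (ler_wpM2l (sqr_ge0 M) (sqsum_ip_le x n)).
  rewrite /sqsum mulr_sumr; apply: ler_sum => k _.
  rewrite rnormM exprMn mulrC ler_wpM2r ?sqr_ge0// lerXn2r// nnegrE ?rnorm_ge0//.
  exact: le_trans (rnorm_ge0 _) (mM k).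
by exists w.
Qed.

End Orthonormal.

(** * From the expansion to division *)

Section Sampling.
Context {R : realType} {X : completeNormedModType R[i]} {ip : X -> X -> R[i]}.
Context (Hip : is_inner_product ip).
Context {F : R[i] -> X -> X} (HF : op_entire F).
Context {u : nat -> X} (Hu : orthonormal_basis ip u).
Context {zs c : nat -> R[i]} (Hc : forall n, c n != 0).
Context (HFz : forall n v, F (zs n) v = (c n * ip v (u n)) *: u n).
Local Open Scope complex_scope.
Local Notation C := R[i].

(** * Linearity, continuity and differentiability of F, and its values at the nodes *)

Lemma F_lin z a x y : F z (a *: x + y) = a *: F z x + F z y.
Proof. by case: HF => /(_ z)[+ _] _. Qed.

Lemma F_D z x y : F z (x + y) = F z x + F z y.
Proof. by have := F_lin z 1 x y; rewrite !scale1r. Qed.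

Lemma F_0 z : F z 0 = 0.
Proof. by apply: (addrI (F z 0)); rewrite -F_D !addr0. Qed.

Lemma F_Z z a x : F z (a *: x) = a *: F z x.
Proof. by have := F_lin z a x 0; rewrite F_0 !addr0. Qed.

Lemma F_B z x y : F z (x - y) = F z x - F z y.
Proof. by rewrite F_D -scaleN1r F_Z scaleN1r. Qed.

Lemma F_usum z a n : F z (usum (u := u) a n) = \sum_(k < n) a k *: F z (u k).
Proof.
elim: n => [|n IH]; first by rewrite /usum !big_ord0 F_0.
by rewrite usumS F_D F_Z IH big_ord_recr.
Qed.

Lemma F_bound z : exists M : R, forall x, rnorm (F z x) <= M * rnorm x.
Proof.
(* An inequality in [R[i]] compares real parts, so the real part [M1] serves as bound. *)
case: HF => /(_ z)[_ [[M1 M2] FM]] _; exists M1 => x; have := FM x.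
rewrite !rnormE lecE => /andP[_] /=; by rewrite mulr0 subr0.
Qed.

Lemma F_tends z s x : tends s x -> tends (fun n => F z (s n)) (F z x).
Proof.
have [M FM] := F_bound z.
move=> sx; apply: (tends_dom (K := `|M|) (N0 := 0%N) _ sx sx) => n _.
rewrite -F_B; apply: le_trans (FM _) _.
have := rnorm_ge0 (s n - x); have := ler_norm M; have := normr_ge0 M; nra.
Qed.

Lemma F_cdiff z v : exists d, cdiff (F ^~ v) z d.
Proof.
case: HF => _ /(_ z)[L [_ FL]]; exists (L v) => e e0.
have v0 := rnorm_ge0 v; have v1 : 0 < rnorm v + 1 by lra.
(* The operator-norm estimate carries a factor |v|; the added 1 covers v = 0. *)
have : 0 < (e / (rnorm v + 1))%:C by rewrite ltcR divr_gt0.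
move=> /FL[d [/eps_real[dl dl0 ->] FLd]]; exists dl => // w wz.
have [->|wz0] := eqVneq w z; first by rewrite !subrr scale0r subr0 !rnorm0 mulr0.
have wz1 : 0 < rnorm (w - z) by rewrite rnorm_gt0 subr_eq0.
have : 0 < `|w - z| < dl%:C by rewrite rnormE !ltcR wz1 wz.
move=> /FLd/(_ v); rewrite !rnormE -rmorphM lecR => h.
have -> : F w v - F z v - (w - z) *: L v =
    (w - z) *: ((w - z)^-1 *: (F w v - F z v) - L v).
  by rewrite [RHS]scalerBr scalerA mulfV ?scale1r// subr_eq0.
rewrite rnormZ mulrC ler_wpM2r ?rnorm_ge0//; apply: le_trans h _.
by rewrite mulrAC ler_pdivrMr//; nra.
Qed.

Lemma u_neq0 n : u n != 0.
Proof.
apply/eqP => un0; have := ip_u Hu n n; rewrite un0 (ip0l Hip) eqxx => /esym/eqP.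
by rewrite oner_eq0.
Qed.

Lemma ip_Fzs n x : ip (F (zs n) x) (u n) = c n * ip x (u n).
Proof. by rewrite HFz (ipZl Hip) (ip_u Hu) eqxx mulr1. Qed.

Lemma Fzs_u n m : F (zs m) (u n) = (c n *+ (n == m)) *: u n.
Proof.
rewrite HFz (ip_u Hu); case: eqVneq => [->|_]; first by rewrite mulr1 mulr1n.
by rewrite mulr0 mulr0n !scale0r.
Qed.

(** At a node shared by n and m, F (.) u_n would equal both c_n u_n and 0. *)
Lemma zs_inj n m : zs n = zs m -> n = m.
Proof.
move=> nm; apply/eqP; apply: contraT => /negbTE nmF.
have := Fzs_u n n; rewrite {1}nm Fzs_u nmF eqxx mulr0n mulr1n scale0r => /esym/eqP.
by rewrite scaler_eq0 (negbTE (Hc n)) (negbTE (u_neq0 n)).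
Qed.

(** Condition (b) without derivatives: both sides vanish at z = b. *)
Definition division_invariant := forall (b : C) v, F b v = 0 ->
  exists w, forall z, F z v = (z - b) *: F z w.

(** The value f'(b) prescribed at b agrees with F b w by [cdiff_root]; conversely the factor z - b
    hides that value. *)
Lemma division_invariantP : division_invariant <->
  (forall (b : C) f, in_HF F f -> f b = 0 -> in_HF F (Rop b f)).
Proof.
split=> [di b _ [v ->] /di[w Fw]|Rinv b v Fb].
  exists w; apply/funext => z; rewrite /Rop; case: eqVneq => [->|zb].
    have [d Fd] := F_cdiff b w.
    exact: (cdiff_derivable (cdiff_root Fd Fw)).2.
  by rewrite Fw scalerA mulVf ?scale1r// subr_eq0.
have [|w Rw] := Rinv b (F ^~ v) _ Fb; first by exists v.
exists w => z; have [->|zb] := eqVneq z b; first by rewrite subrr scale0r.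
have <- : Rop b (F ^~ v) z = F z w by rewrite Rw.
by rewrite /Rop (negbTE zb) scalerA mulfV ?scale1r// subr_eq0.
Qed.

(** A complex line is closed: the coordinates of a convergent sequence on it are Cauchy. *)
Lemma tends_scaler (s : nat -> C) (x y : X) : x != 0 -> tends (fun n => s n *: x) y ->
  exists2 S, tends s S & y = S *: x.
Proof.
rewrite -rnorm_gt0 => x0 sxy; have [|S sS] := complex_complete (f := s).
  move=> e e0; have e1 : 0 < e * rnorm x / 2 by rewrite divr_gt0// mulr_gt0.
  have [N Nx] := sxy _ e1; exists N => n Nn.
  rewrite -(ltr_pM2r x0) -rnormZ scalerBl.
  have := rnormD (s n *: x - y) (y - s N *: x); rewrite addrA subrK (rdistC y).
  have := Nx n Nn; have := Nx N (leqnn N); lra.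
by exists S => //; apply: tends_uniq sxy (tendsZ sS (tends_cst x)).
Qed.

(** Where Q b != 0 this is continuity. At a zero, the linear term Q'(b) (z - b) would exceed the
    remainder at a second zero nearby. *)
Lemma simple_zeros_isolated (Q : C -> C) b : entire (Q : C -> R[i]^o) ->
  (forall z, Q z = 0 <-> exists n, z = zs n) ->
  (forall n, cderiv (Q : C -> R[i]^o) (zs n) != 0) ->
  exists2 dl : R, 0 < dl & forall z, Q z = 0 -> z != b -> dl <= rnorm (z - b).
Proof.
move=> /(_ b)/derivable_cdiff Qe Qz Qd; have [Qb|Qb] := eqVneq (Q b) 0; last first.
  have [dl dl0 Qdl] := cdiff_neq0 Qe Qb; exists dl => // z Qz0 _.
  rewrite leNgt; apply/negP => /Qdl; rewrite Qz0 rnorm0.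
  by move: Qb; rewrite -rnorm_gt0; lra.
have [n bn] := (Qz b).1 Qb; set D := cderiv _ b in Qe.
have D0 : 0 < rnorm D by rewrite rnorm_gt0 /D bn; exact: Qd.
have [|dl dl0 Qdl] := Qe (rnorm D / 2); first lra.
exists dl => // z Qz0 zb; rewrite leNgt; apply/negP => /Qdl.
rewrite Qz0 Qb subrr sub0r rnormN rnormZ.
have : 0 < rnorm (z - b) by rewrite rnorm_gt0 subr_eq0.
nra.
Qed.

Lemma expansion_division (Q : C -> C) (A : C -> X) : entire (Q : C -> R[i]^o) ->
  (forall z, Q z = 0 <-> exists n, z = zs n) ->
  (forall n, cderiv (Q : C -> R[i]^o) (zs n) != 0) ->
  (forall z, A z != 0) -> (forall n, ip (A (zs n)) (u n) != 0) ->
  (forall f, in_HF F f -> forall z,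
    series (fun n => (ip (f (zs n)) (u n)
      * (Qker Q (zs n) z / cderiv (Q : C -> R[i]^o) (zs n))
      / ip (A (zs n)) (u n)) *: A z) @ \oo --> f z) ->
  division_invariant.
Proof.
move=> Qe Qz Qd An Au Hexp b v Fb.
(* With these weights the expansion of F (.) x has coefficients x_n d_n against the kernels Q / (z -
   z_n). *)
pose d n := c n / (cderiv (Q : C -> R[i]^o) (zs n) * ip (A (zs n)) (u n)).
have d0 n : d n != 0 by rewrite mulf_neq0 ?invr_eq0 ?mulf_neq0.
have exp x z : tends (fun N => (\sum_(k < N) ip x (u k) * d k * Qker Q (zs k) z) *: A z)
    (F z x).
  have /tends_cvg := Hexp (F ^~ x) (ex_intro _ x erefl) z.
  apply: (tends_near (N := 0%N)) => N _; rewrite seriesEord/= scaler_suml.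
  apply: eq_bigr => k _; congr (_ *: _); rewrite ip_Fzs /d.
  by field; rewrite Qd Au.
have [dl dl0 Qdl] := simple_zeros_isolated b Qe Qz Qd.
(* The multiplier is bounded by 1 / dl; at a node equal to b the coefficient of v is 0, so any value
   would do. *)
pose m k := if zs k == b then 0 else (zs k - b)^-1.
have vb k : zs k = b -> ip v (u k) = 0.
  move=> kb; have := ip_Fzs k v; rewrite kb Fb (ip0l Hip) => /esym/eqP.
  by rewrite mulf_eq0 (negbTE (Hc k)) => /eqP.
have [|w0 w0E] := riesz_fischer_mul Hip Hu v (m := m) (M := dl^-1).
  move=> k; rewrite /m; case: eqVneq => [_|kb]; first by rewrite rnorm0 invr_ge0 ltW.
  have kdl : dl <= rnorm (zs k - b) by apply: Qdl => //; apply/Qz; exists k.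
  by rewrite rnormV lef_pV2// posrE (lt_le_trans dl0).
pose s N := \sum_(k < N) ip w0 (u k) * d k.
have QkE z k : Q z != 0 -> Qker Q (zs k) z = Q z / (z - zs k).
  move=> Qz0; rewrite /Qker; case: eqVneq => // zk; case/eqP: Qz0.
  by apply/Qz; exists k.
have zk0 z k : Q z != 0 -> z - zs k != 0.
  by move=> Qz0; rewrite subr_eq0; apply: contra_neq Qz0 => ->; apply/Qz; exists k.
(* Partial fractions: (z - b) / ((z_k - b) (z - z_k)) = 1 / (z - z_k) + 1 / (z_k - b). The second
   terms add up to [s N]. *)
have key z : Q z != 0 ->
    tends (fun N => (Q z * s N) *: A z) ((z - b) *: F z w0 - F z v).
  move=> Qz0; have := tendsB (tendsZ (tends_cst (z - b)) (exp w0 z)) (exp v z).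
  apply: (tends_near (N := 0%N)) => N _; rewrite scalerA -scalerBl; congr (_ *: _).
  rewrite /s !mulr_sumr -sumrB; apply: eq_bigr => k _.
  rewrite QkE// w0E /m; case: eqVneq => [/vb ->|kb]; first by rewrite !mul0r !mulr0 subr0.
  by field; rewrite zk0// subr_eq0.
(* Either b itself or, by isolation, a point at distance dl / 2 from it. *)
have [z0 Qz0] : exists z0, Q z0 != 0.
  have [Qb|Qb] := eqVneq (Q b) 0; last by exists b.
  exists (b + (dl / 2)%:C); apply/eqP => Q0; have := Qdl _ Q0.
  rewrite addrAC subrr add0r rnorm_real ger0_norm; last lra.
  rewrite -subr_eq0 addrAC subrr add0r -rnorm_eq0 rnorm_real ger0_norm; last lra.
  have -> : dl / 2 != 0 by rewrite gt_eqF//; lra.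
  by move=> /(_ isT); lra.
have [S sS] : exists S, tends s S.
  have [S' S'1 _] := tends_scaler (An z0) (key z0 Qz0).
  exists ((Q z0)^-1 * S'); apply: (tends_near (N := 0%N)) (tendsM (tends_cst (Q z0)^-1) S'1).
  by move=> n _; rewrite mulKf.
have keyS z : Q z != 0 -> (z - b) *: F z w0 = F z v + (Q z * S) *: A z.
  move=> Qz'; apply/eqP; rewrite [F z v + _]addrC -subr_eq; apply/eqP.
  exact: tends_uniq (key z Qz') (tendsZ (tendsM (tends_cst _) sS) (tends_cst _)).
have [w wE ww] : exists2 w, forall z, Q z != 0 -> (z - b) *: F z w = F z v &
    forall n, zs n != b -> ip w (u n) = ip v (u n) / (zs n - b).
  have w0n n : zs n != b -> ip w0 (u n) = ip v (u n) / (zs n - b).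
    by move=> /negbTE nb; rewrite w0E /m nb.
  have [/Qz[k bk]|Qb] := eqVneq (Q b) 0; last first.
    (* At z = b, [keyS] reads Q(b) S A(b) = 0, whence S = 0. *)
    exists w0 => // z Qz'; rewrite keyS//; have := keyS b Qb.
    rewrite subrr scale0r Fb add0r => /esym/eqP.
    rewrite scaler_eq0 (negbTE (An b)) orbF mulf_eq0 (negbTE Qb) => /eqP ->.
    by rewrite mulr0 scale0r addr0.
  (* Since F (.) u_k = d_k Q / (z - b) A off the zeros of Q, this multiple of u_k absorbs the excess
     S Q A. *)
  exists (w0 - (S / d k) *: u k) => [z Qz'|n nb]; last first.
    rewrite (ipBl Hip) (ipZl Hip) (ip_u Hu) w0n//.
    have /negbTE -> : k != n by apply: contra_neq nb => <-; rewrite bk.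
    by rewrite mulr0 subr0.
  rewrite F_B F_Z scalerBr keyS//.
  have -> : F z (u k) = (d k * (Q z / (z - b))) *: A z.
    apply: tends_uniq (exp (u k) z) _.
    apply: (tends_near (N := k.+1)) (tends_cst _) => N kN; congr (_ *: _).
    rewrite (bigD1 (Ordinal kN))//= (ip_u Hu) eqxx mul1r QkE// big1 ?addr0 ?bk// => j jk.
    rewrite (ip_u Hu); have /negbTE -> : k != j :> nat by apply: contra_neq jk => kj; exact/val_inj.
    by rewrite !mul0r.
  rewrite !scalerA; have -> : (z - b) * (S / d k) * (d k * (Q z / (z - b))) = Q z * S.
    by field; rewrite d0 bk zk0.
  by rewrite addrK.
(* At a node both sides are multiples of one basis vector, and the coefficients of w settle the
   equality. *)
exists w => z; have [/Qz[n ->]|Qz'] := eqVneq (Q z) 0; last by rewrite wE.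
rewrite !HFz scalerA; have [nb|nb] := eqVneq (zs n) b.
  by rewrite vb// nb subrr mul0r mulr0.
rewrite ww//; congr (_ *: _); field.
by rewrite subr_eq0.
Qed.

End Sampling.

(** * From division to the expansion *)

(** Bolzano-Weierstrass, by compactness of a square. The selected indices satisfy k N >= N, so
    clustering occurs along arbitrarily late terms. *)
Lemma complex_cluster (R : realType) (s : nat -> R[i]) (r : R) :
  (forall N, exists2 n, (N <= n)%N & rnorm (s n) < r) ->
  exists b, forall (dl : R) N, 0 < dl -> exists2 n, (N <= n)%N & rnorm (s n - b) < dl.
Proof.
move=> sr.
have /choice[k kP] : forall N, exists n, (N <= n)%N /\ rnorm (s n) < r.
  by move=> N; have [n ? ?] := sr N; exists n.
pose p n : R * R := (complex.Re (s (k n)), complex.Im (s (k n))).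
have cA : compact (`[-r, r]%classic `*` `[-r, r]%classic : set (R * R)).
  by apply: compact_setX; exact: segment_compact.
have [|[x y] [_ xy]] := cA (p @ \oo) _.
  exists 0%N => // n _; have [_ sn] := kP n; rewrite /= !in_itv/= -!ler_norml.
  by split; apply: le_trans (ltW sn); [exact: le_rnorm_Re|exact: le_rnorm_Im].
exists (Complex x y) => dl N dl0.
have d2 : 0 < dl / 2 by lra.
have pF : (p @ \oo) (p @` [set n | (N <= n)%N]) by exists N => // n Nn; exists n.
have pB : nbhs (x, y) (ball x (dl / 2) `*` ball y (dl / 2)).
  by exists (ball x (dl / 2), ball y (dl / 2)) => //=; split; apply: nbhsx_ballx.
have [_ [[n /= Nn <-] []]] := xy _ _ pF pB.
rewrite /ball/= => xn yn; exists (k n).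
  by rewrite (leq_trans Nn)//; case: (kP n).
apply: le_lt_trans (rnorm_le_ReIm _) _; rewrite !raddfB/= distrC.
by rewrite [X in _ + X]distrC; lra.
Qed.

(** * Zeros and proportionality of the functions F (.) u_n *)

Section Division.
Context {R : realType} {X : completeNormedModType R[i]} {ip : X -> X -> R[i]}.
Context (Hip : is_inner_product ip).
Context {F : R[i] -> X -> X} (HF : op_entire F).
Context {u : nat -> X} (Hu : orthonormal_basis ip u).
Context {zs c : nat -> R[i]} (Hc : forall n, c n != 0).
Context (HFz : forall n v, F (zs n) v = (c n * ip v (u n)) *: u n).
Context (Hdiv : division_invariant (F := F)).
Local Open Scope complex_scope.
Local Notation C := R[i].

Lemma Fu_neq0 n : F (zs n) (u n) != 0.
Proof.
rewrite (Fzs_u Hu HFz) eqxx mulr1n scaler_eq0 negb_or Hc.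
exact: (u_neq0 Hip Hu).
Qed.

Lemma Fu_eq0 n m : m != n -> F (zs m) (u n) = 0.
Proof. by rewrite eq_sym (Fzs_u Hu HFz) => /negbTE ->; rewrite mulr0n scale0r. Qed.

Lemma Fu_near_neq0 b n : F b (u n) != 0 ->
  exists2 dl : R, 0 < dl & forall z, rnorm (z - b) < dl -> F z (u n) != 0.
Proof.
move=> Fb; have [d Fd] := F_cdiff HF b (u n); have [dl dl0 Fdl] := cdiff_neq0 Fd Fb.
exists dl => // z /Fdl; rewrite -!rnorm_gt0; apply: lt_le_trans.
by rewrite divr_gt0// rnorm_gt0.
Qed.

(** Otherwise F (.) u_n would vanish off z_n while being continuous and nonzero at z_n. *)
Lemma Fu_not_point_supported n : ~ (forall z, (z - zs n) *: F z (u n) = 0).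
Proof.
move=> F0; have [dl dl0 Fdl] := Fu_near_neq0 (Fu_neq0 n).
pose z := zs n + (dl / 2)%:C.
have zE : rnorm (z - zs n) = dl / 2.
  by rewrite /z addrAC subrr add0r rnorm_real ger0_norm//; lra.
have /negP : F z (u n) != 0 by apply: Fdl; rewrite zE; lra.
have /eqP := F0 z; rewrite scaler_eq0 => /orP[|//].
by rewrite -rnorm_eq0 zE => /eqP; lra.
Qed.

(** Evaluating at a node reads off one coefficient; the node b itself gives no information. *)
Lemma division_coef b n w : (forall z, F z (u n) = (z - b) *: F z w) ->
  forall m, zs m != b -> ip w (u m) = (m == n)%:R / (zs m - b).
Proof.
move=> Fw m mb; have := congr1 (ip ^~ (u m)) (Fw (zs m)).
rewrite (ipZl Hip) !(ip_Fzs Hip Hu HFz) (ip_u Hu) eq_sym mulrCA => /(mulfI (Hc m)) ->.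
by rewrite [_ * ip w _]mulrC mulfK// subr_eq0.
Qed.

(** If b were no other node, dividing by z - b would give w = u_n / (z_n - b), so (z - z_n) F (.)
    u_n would vanish identically. *)
Lemma Fu_zero b n : F b (u n) = 0 -> exists2 m, m != n & b = zs m.
Proof.
move=> Fb; apply: contrapT => nb; have [w Fw] := Hdiv Fb.
have zb m : zs m != b.
  apply/eqP => mb; have [mn|mn] := eqVneq m n; last by apply: nb; exists m.
  by have := Fu_neq0 n; rewrite -mn mb mn Fb eqxx.
have wE : w = (zs n - b)^-1 *: u n.
  apply: (ip_u_inj Hip Hu) => m; rewrite (division_coef Fw)// (ipZl Hip) (ip_u Hu).
  by rewrite eq_sym; case: eqVneq => [->|_]; rewrite ?mul1r ?mulr1 ?mul0r ?mulr0.
apply: (@Fu_not_point_supported n) => z.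
have := Fw z; rewrite wE (F_Z HF) scalerA => /(congr1 (fun x => (zs n - b) *: x)).
rewrite scalerA mulrCA mulfV ?subr_eq0// mulr1 => /eqP.
by rewrite -subr_eq0 -scalerBl opprB addrA subrK -opprB scaleNr oppr_eq0 => /eqP.
Qed.

(** F (.) u_n vanishes at z_0, and the quotient by z - z_0 comes from a vector in the span of u_n
    and u_0. *)
Lemma Fu_proportional n : exists2 k, k != 0 &
  forall z, (z - zs n) *: F z (u n) = k *: ((z - zs 0) *: F z (u 0)).
Proof.
have [->|n0] := eqVneq n 0%N; first by exists 1; rewrite ?oner_eq0// => z; rewrite scale1r.
have zn0 : zs n - zs 0 != 0.
  by rewrite subr_eq0; apply: contra_neq n0 => /(zs_inj Hip Hu Hc HFz).
have [|w Fw] := Hdiv (b := zs 0) (v := u n); first by rewrite Fu_eq0// eq_sym.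
(* The coefficient of w at u_0 is the one left open by [division_coef]; solving for (z - z_n) F (.)
   u_n produces this constant. *)
pose k := - ((zs n - zs 0) * ip w (u 0)).
have kE z : (z - zs n) *: F z (u n) = k *: ((z - zs 0) *: F z (u 0)).
  have wE : w = (zs n - zs 0)^-1 *: u n + ip w (u 0) *: u 0.
    apply: (ip_u_inj Hip Hu) => m; rewrite (ipDl Hip) !(ipZl Hip) !(ip_u Hu).
    have [->|m0] := eqVneq m 0%N.
      by rewrite (negbTE n0) mulr0 add0r mulr1.
    rewrite mulr0 addr0 (division_coef Fw).
      by case: (eqVneq n m) => [->|_]; rewrite ?mul1r ?mulr1// mul0r mulr0.
    by apply: contra_neq m0 => /(zs_inj Hip Hu Hc HFz).
  have FE := Fw z; rewrite [in RHS]wE (F_D HF) !(F_Z HF) in FE.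
  have -> : z - zs n = (z - zs 0) - (zs n - zs 0) by rewrite opprB addrA subrK.
  rewrite [LHS]scalerBl {2}FE !scalerDr !scalerA.
  rewrite [_ * (z - zs 0) / _]mulrAC mulfV// mul1r opprD addrA subrr sub0r.
  by rewrite -scaleNr; congr (_ *: _); rewrite /k; ring.
exists k => //; apply/eqP => k0; apply: (@Fu_not_point_supported n) => z.
by rewrite kE k0 scale0r.
Qed.

End Division.

(** * Discreteness of the nodes and construction of Q and A *)

Section Factorization.
Context {R : realType} {X : completeNormedModType R[i]} {ip : X -> X -> R[i]}.
Context (Hip : is_inner_product ip).
Context {F : R[i] -> X -> X} (HF : op_entire F).
Context {u : nat -> X} (Hu : orthonormal_basis ip u).
Context {zs c : nat -> R[i]} (Hc : forall n, c n != 0).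
Context (HFz : forall n v, F (zs n) v = (c n * ip v (u n)) *: u n).
Context (Hdiv : division_invariant (F := F)).
Local Open Scope complex_scope.
Local Notation C := R[i].

(** Some F (.) u_n is nonzero near b, while it vanishes at all nodes except z_n. *)
Lemma zs_discrete b : exists2 dl : R, 0 < dl & forall m p,
  rnorm (zs m - b) < dl -> rnorm (zs p - b) < dl -> m = p.
Proof.
have [n Fb] : exists n, F b (u n) != 0.
  have [[n bn]|nb] := pselect (exists n, b = zs n).
    by exists n; rewrite bn; exact: (Fu_neq0 Hip Hu Hc HFz n).
  exists 0%N; apply/eqP => /(Fu_zero Hip HF Hu Hc HFz Hdiv)[m _ bm].
  by apply: nb; exists m.
have [dl dl0 Fdl] := Fu_near_neq0 HF Fb; exists dl => //.
suff H m : rnorm (zs m - b) < dl -> m = n by move=> m p /H -> /H ->.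
move=> /Fdl Fm; apply/eqP; apply: contraT => mn.
by rewrite (Fu_eq0 Hu HFz mn) eqxx in Fm.
Qed.

Lemma zs_infty r : exists N, forall n, (N <= n)%N -> r <= rnorm (zs n).
Proof.
apply: contrapT => nN; have [|b bz] := @complex_cluster _ zs r.
  move=> N; apply: contrapT => nn; apply: nN; exists N => n Nn.
  by rewrite leNgt; apply/negP => nr; apply: nn; exists n.
have [dl dl0 zdl] := zs_discrete b.
have [n _ nb] := bz dl 0%N dl0; have [m nm mb] := bz dl n.+1 dl0.
by move: nm; rewrite (zdl _ _ mb nb) ltnn.
Qed.

Lemma division_expansion : exists (Q : C -> C) (A : C -> X),
  [/\ entire (Q : C -> R[i]^o),
      (forall z, Q z = 0 <-> exists n, z = zs n)
    & (forall n, cderiv (Q : C -> R[i]^o) (zs n) != 0)] /\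
  [/\ entire A,
      (forall z, A z != 0),
      (forall n, ip (A (zs n)) (u n) != 0)
    & forall f : C -> X, in_HF F f -> forall z : C,
        series (fun n => (ip (f (zs n)) (u n)
                           * (Qker Q (zs n) z / cderiv (Q : C -> R[i]^o) (zs n))
                           / ip (A (zs n)) (u n)) *: A z) @ \oo --> f z].
Proof.
have [Q [Q' [q [q' [Qe qe Qq q0]]]]] := weierstrass zs_infty.
have /choice[k kP] : forall n, exists k, k != 0 /\ forall z,
    (z - zs n) *: F z (u n) = k *: ((z - zs 0) *: F z (u 0)).
  by move=> n; have [k ? ?] := Fu_proportional Hip HF Hu Hc HFz Hdiv n; exists k.
have k0 n : k n != 0 by case: (kP n).
have kE n z : (z - zs n) *: F z (u n) = k n *: ((z - zs 0) *: F z (u 0)).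
  by case: (kP n).
have qzs n m : n != m -> q n (zs m) = 0.
  move=> nm; have := Qq n (zs m); rewrite (Qq m) subrr mul0r => /esym/eqP.
  rewrite mulf_eq0 subr_eq0 => /orP[/eqP/(zs_inj Hip Hu Hc HFz) mn|/eqP//].
  by rewrite mn eqxx in nm.
have qn n : q n (zs n) != 0.
  apply/eqP => /q0[m mn /(zs_inj Hip Hu Hc HFz) nm].
  by rewrite nm eqxx in mn.
have Qz z : Q z = 0 <-> exists n, z = zs n.
  split=> [Qz0|[n ->]]; last by rewrite (Qq n) subrr mul0r.
  have [->|zn] := eqVneq z (zs 0); first by exists 0%N.
  move/eqP: Qz0; rewrite (Qq 0%N) mulf_eq0 subr_eq0 (negbTE zn) => /eqP/q0[m _ ->].
  by exists m.
(* A nonvanishing cofactor is selected at each z, so that A can be defined by division at every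
   point. *)
have /choice[nu nuP] : forall z, exists n, q n z != 0.
  move=> z; have [[n ->]|nz] := pselect (exists n, z = zs n); first by exists n.
  by exists 0%N; apply/eqP => /q0[m _ zm]; apply: nz; exists m.
(* The quotient F (.) u_n / (k_n q_n) does not depend on n; at z_n and z_m both sides vanish. *)
have cross n m z : (k m * q m z) *: F z (u n) = (k n * q n z) *: F z (u m).
  have [->//|nm] := eqVneq n m.
  have [->|zn] := eqVneq z (zs n).
    by rewrite qzs 1?eq_sym// (Fu_eq0 Hu HFz nm) mulr0 scale0r scaler0.
  have [->|zm] := eqVneq z (zs m).
    by rewrite (qzs n)// (Fu_eq0 Hu HFz (_ : m != n)) 1?eq_sym// mulr0 scale0r scaler0.
  have znm : (z - zs n) * (z - zs m) != 0 by rewrite mulf_neq0// subr_eq0.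
  apply: (scalerI znm); rewrite !scalerA.
  have -> : (z - zs n) * (z - zs m) * (k m * q m z) = (k m * Q z) * (z - zs n).
    by rewrite (Qq m); ring.
  have -> : (z - zs n) * (z - zs m) * (k n * q n z) = (k n * Q z) * (z - zs m).
    by rewrite (Qq n); ring.
  by rewrite -[LHS]scalerA -[RHS]scalerA (kE n) (kE m) !scalerA; congr (_ *: _); ring.
pose A z := (k (nu z) * q (nu z) z)^-1 *: F z (u (nu z)).
have FA n z : F z (u n) = (k n * q n z) *: A z.
  rewrite /A scalerA mulrC -scalerA -cross scalerA mulVf ?scale1r//.
  by rewrite mulf_neq0.
have Qcd n : cdiff (Q : C -> R[i]^o) (zs n) (q n (zs n)).
  exact: cdiff_root (ctl_cdiff (zs n) (qe n)) (Qq n).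
have Qd n : cderiv (Q : C -> R[i]^o) (zs n) = q n (zs n).
  exact: (cdiff_derivable (Qcd n)).2.
have ipA n : ip (A (zs n)) (u n) = c n / (k n * q n (zs n)).
  have := congr1 (ip ^~ (u n)) (FA n (zs n)).
  rewrite (ip_Fzs Hip Hu HFz) (ip_u Hu) eqxx mulr1 (ipZl Hip) => ->.
  by rewrite [_ * ip _ _]mulrC mulfK// mulf_neq0.
(* The kernel extended by continuity is exactly the cofactor. *)
have QkerE n z : Qker Q (zs n) z = q n z.
  rewrite /Qker Qd; case: eqVneq => [->//|zn].
  by rewrite (Qq n) mulrC mulKf// subr_eq0.
exists Q, A; split; split=> //.
- by move=> z; have [] := cdiff_derivable (ctl_cdiff z Qe).
- by move=> n; rewrite Qd.
(* With the index frozen at [nu z], [FA] holds at every point, so the quotient rule applies although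
   A was defined with varying indices. *)
- move=> z; have [d Fd] := F_cdiff HF z (u (nu z)).
  have kqe : ctl_entire (fun w => k (nu z) * q (nu z) w) (fun w => k (nu z) * q' (nu z) w).
    by move=> r r0; have [b qb] := qe (nu z) r r0; eexists; exact: ctlZ qb.
  have [] // := cdiff_derivable (cdiff_div (ctl_cdiff z kqe) Fd _ (FA (nu z))).
  by rewrite mulf_neq0.
(* A zero of A would be a node other than that of index [nu z], where the selected cofactor
   vanishes. *)
- move=> z; apply/eqP => Az0; have := FA (nu z) z; rewrite Az0 scaler0.
  move=> /(Fu_zero Hip HF Hu Hc HFz Hdiv)[m mn zm].
  by have := nuP z; rewrite {2}zm qzs ?eqxx// eq_sym.
- by move=> n; rewrite ipA mulf_neq0 ?invr_eq0 ?mulf_neq0.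
(* The partial sums of the expansion are the images under F z of the Fourier partial sums of v. *)
move=> _ [v ->] z; apply/tends_cvg.
apply: (tends_near (N := 0%N)) (F_tends HF z (fourier Hip Hu v)) => n _.
rewrite seriesEord/= (F_usum HF); apply: eq_bigr => j _.
rewrite FA [RHS]scalerA; congr (_ *: _); rewrite (ip_Fzs Hip Hu HFz) QkerE Qd ipA.
by field; rewrite Hc k0 qn.
Qed.

End Factorization.

Unset Implicit Arguments.
Set Strict Implicit.
Set Printing Implicit Defensive.

Theorem theorem4p1 (R : realType) (X : completeNormedModType R[i])
  (ip : X -> X -> R[i]) (Hip : is_inner_product ip)
  (Hsep : separable_space X)
  (F : R[i] -> X -> X) (HF : op_entire F)
  (u : nat -> X) (Hu : orthonormal_basis ip u)
  (zs : nat -> R[i]) (c : nat -> R[i]) (Hc : forall n, c n != 0)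
  (HFz : forall (n : nat) (v : X), F (zs n) v = (c n * ip v (u n)) *: u n) :
  (exists (Q : R[i] -> R[i]) (A : R[i] -> X),
      [/\ entire (Q : R[i] -> R[i]^o),
          (forall z, Q z = 0 <-> exists n, z = zs n)
        & (forall n, cderiv (Q : R[i] -> R[i]^o) (zs n) != 0)] /\
      [/\ entire A,
          (forall z, A z != 0),
          (forall n, ip (A (zs n)) (u n) != 0)
        & forall f : R[i] -> X, in_HF F f -> forall z : R[i],
            series (fun n => (ip (f (zs n)) (u n)
                               * (Qker Q (zs n) z / cderiv (Q : R[i] -> R[i]^o) (zs n))
                               / ip (A (zs n)) (u n)) *: A z) @ \oo --> f z])
  <->
  (forall (beta : R[i]) (f : R[i] -> X), in_HF F f -> f beta = 0 ->
      in_HF F (Rop beta f)).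
Proof.
rewrite -(division_invariantP HF); split; last exact: (division_expansion Hip HF Hu Hc HFz).
move=> [Q [A [[Qe Qz Qd] [_ An Au Hexp]]]].
exact: (expansion_division Hip HF Hu Hc HFz Qe Qz Qd An Au Hexp).
Qed.
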